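(* Let $1\le p\le\infty$ and let $p'$ be the conjugate index, $\frac1p+\frac1{p'}=1$. A map $T:AC_p\to AC_p$ is a multiplier if and only if there exists a bounded continuous function $m:(0,1]\to\mathbb{C}$ such that $Tg=mg$ for all $g\in AC_p$ and, for each $\epsilon\in(0,1)$, $m$ is absolutely continuous on $[\epsilon,1]$, $m'\in L^p[\epsilon,1]$, and $$\|m'\chi_{[\epsilon,1]}\|_p=O(\epsilon^{-1/p'}),$$ i.e. there is a constant $A$ with $\|m'\chi_{[\epsilon,1]}\|_p\le A\,\epsilon^{-1/p'}$ for all $\epsilon\in(0,1)$ (where $\epsilon^{-1/p'}$ is read as $1$ when $p=1$).
   Context: For $1\le p\le\infty$, $AC_p$ denotes the commutative algebra (under pointwise operations) of absolutely continuous functions $f:[0,1]\to\mathbb{C}$ with $f(0)=0$ and $f'\in L^p[0,1]$, with norm $|||f|||=\|f'\|_p$. A map $T:AC_p\to AC_p$ is a multiplier if $T(fg)=f\,T(g)=T(f)\,g$ for all $f,g\in AC_p$. For $m:(0,1]\to\mathbb{C}$ and $g\in AC_p$, $mg$ denotes the function on $[0,1]$ equal to $m(t)g(t)$ for $t\in(0,1]$ and to $0$ at $t=0$. $\chi_E$ is the indicator function of $E$. For $p=\infty$, $p'=1$. *)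

(* Defs.v *)
From HB Require Import structures.
From mathcomp Require Import all_boot all_order all_algebra.
From mathcomp Require Import all_classical all_reals all_analysis.
From mathcomp.real_closed Require Import complex.

Set Implicit Arguments.
Unset Strict Implicit.
Unset Printing Implicit Defensive.
Import Order.TTheory GRing.Theory Num.Theory.
Import numFieldNormedType.Exports.
Import Normc.

Local Open Scope classical_set_scope.
Local Open Scope ring_scope.
Local Open Scope complex_scope.

Definition abs_continuous (R : realType) (a b : R) (f : R -> R[i]) : Prop :=
  forall e : R, 0 < e -> exists2 d : R, 0 < d &
    forall (n : nat) (s t : 'I_n -> R),
      (forall i, a <= s i /\ s i <= t i /\ t i <= b) ->
      trivIset [set: 'I_n] (fun i => `]s i, t i[%classic) ->
      \sum_(i < n) (t i - s i) < d ->
      \sum_(i < n) normc (f (t i) - f (s i)) < e.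

(* [derive1] is total: it is a junk value wherever the real or the imaginary part
   is not differentiable.  For an absolutely continuous function on an interval
   this concerns only a null subset of that interval. *)
Definition cderive (R : realType) (f : R -> R[i]) (x : R) : R[i] :=
  derive1 (fun y => complex.Re (f y)) x +i* derive1 (fun y => complex.Im (f y)) x.

(* The norm of [h \1_D] in L^p of the line. *)
Definition Lpnorm (R : realType) (p : \bar R) (D : set R) (h : R -> R[i]) :
    \bar R :=
  Lnorm lebesgue_measure p (fun x : R => (normc (h x) * \1_D x)%:E).

(* [h] is regarded as a function defined almost everywhere on [D].
   [measurable_fun] refers to the Borel sigma-algebra; a function is Lebesgue
   measurable iff it agrees almost everywhere with a Borel function. *)
Definition in_Lp (R : realType) (p : \bar R) (D : set R) (h : R -> R[i]) :
    Prop :=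
  (exists k : R -> R[i],
      [/\ measurable_fun [set: R] (fun x => complex.Re (k x)),
          measurable_fun [set: R] (fun x => complex.Im (k x)) &
          {ae lebesgue_measure, forall x : R, D x -> h x = k x}]) /\
  (Lpnorm p D h < +oo)%E.

Definition unit_itv (R : realType) : set R := `[0, 1].
Arguments unit_itv : clear implicits.

(* The subtype [unit_itv R] is the domain, so that two functions are equal iff
   they agree on [0,1]; ['valL_0 f] is the extension of [f] by 0. *)
Definition ACp (R : realType) (p : \bar R) : set (unit_itv R -> R[i]) :=
  [set f | [/\ abs_continuous 0 1 ('valL_0 f), 'valL_0 f 0 = 0 &
               in_Lp p `[0, 1] (cderive ('valL_0 f))]].

(* A map from ACp to itself is modelled by a [T : {fun ACp p >-> ACp p}], whose
   values outside ACp are irrelevant. *)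
Definition multiplier (R : realType) (p : \bar R)
    (T : {fun ACp (R := R) p >-> ACp (R := R) p}) : Prop :=
  forall f g, ACp p f -> ACp p g ->
    T (f \* g) = f \* T g /\ T (f \* g) = T f \* g.

Definition mulfun (R : realType) (m : R -> R[i])
    (g : unit_itv R -> R[i]) : unit_itv R -> R[i] :=
  fun t => if val t == 0 then 0 else m (val t) * g t.

(* Main.v *)
(* Since [T (id * g) = id * T g = T id * g], the symbol is [m = T id / id],
   which is absolutely continuous on every [[eps, 1]].

   Both bounds on [m] come from one family of test functions instead of the
   closed graph theorem: for every sequence [eps_k] in ]0, 1] some [G] in [AC_p]
   satisfies [G >= 2^-(k+1) * eps_k^(1/p')] on [[eps_k, 1]] for all [k].  As
   [m G] is in [AC_p], Hoelder's inequality gives [|m G| (t) = O(t^(1/p'))], so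
   [|m (eps_k)| > k 2^(k+1)] for all [k] is impossible.  As [m] is bounded,
   [m' G = (m G)' - m G'] is in [L^p], so the norm of [m'] on [[eps_k, 1]] cannot
   exceed [k 2^(k+1) eps_k^(-1/p')] for all [k] either.

   The calculus used here needs that an absolutely continuous [f] is almost
   everywhere differentiable and is the integral of its derivative.  The total
   variation function [V] of [f] is absolutely continuous, so the Stieltjes
   measures of [V] and [V - f] are dominated by the Lebesgue measure; their
   Radon-Nikodym densities and the Lebesgue differentiation theorem conclude. *)
Require Import Defs.
From HB Require Import structures.
From mathcomp Require Import all_boot all_order all_algebra.
From mathcomp Require Import all_classical all_reals all_analysis.
From mathcomp.real_closed Require Import complex.
From mathcomp Require Import finmap ring lra measurable_realfun ess_sup_inf.

Set Implicit Arguments.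
Unset Strict Implicit.
Unset Printing Implicit Defensive.
Import Order.TTheory GRing.Theory Num.Theory.
Import numFieldNormedType.Exports.
Import Normc.

Local Open Scope classical_set_scope.
Local Open Scope ring_scope.
Local Open Scope complex_scope.

(** * Absolutely continuous real functions *)

(* Families indexed by an arbitrary finite type, so that the subintervals of all
   partitions of the members of a family form a family again. *)
Definition real_ac (R : realType) (a b : R) (f : R -> R) : Prop :=
  forall e : R, 0 < e -> exists2 d : R, 0 < d &
    forall (I : finType) (s t : I -> R),
      (forall i, a <= s i /\ s i <= t i /\ t i <= b) ->
      trivIset [set: I] (fun i => `]s i, t i[%classic) ->
      \sum_i (t i - s i) < d ->
      \sum_i `|f (t i) - f (s i)| < e.

Section real_ac.
Context (R : realType).
Implicit Types (a b : R) (f g : R -> R).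

Lemma real_ac_of_ord a b f :
  (forall e : R, 0 < e -> exists2 d : R, 0 < d &
    forall (n : nat) (s t : 'I_n -> R),
      (forall i, a <= s i /\ s i <= t i /\ t i <= b) ->
      trivIset [set: 'I_n] (fun i => `]s i, t i[%classic) ->
      \sum_(i < n) (t i - s i) < d ->
      \sum_(i < n) `|f (t i) - f (s i)| < e) -> real_ac a b f.
Proof.
move=> H e /H[d d0 {}H]; exists d => // I s t stab tI.
rewrite (reindex (@enum_val I predT)) /=; last first.
  by apply: onW_bij; exact: enum_val_bij.
rewrite [X in _ -> X < _](reindex (@enum_val I predT)) /=; last first.
  by apply: onW_bij; exact: enum_val_bij.
apply: (H _ (s \o enum_val) (t \o enum_val)) => [i|]; first exact: stab.
move=> i j _ _ ij; apply: enum_val_inj; exact: tI.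
Qed.

Lemma real_acD a b f g : real_ac a b f -> real_ac a b g ->
  real_ac a b (f \+ g).
Proof.
move=> acf acg e e0; have e20 : 0 < e / 2 by rewrite divr_gt0.
have [d d0 df] := acf _ e20; have [d' d'0 dg] := acg _ e20.
exists (Num.min d d'); first by rewrite lt_min d0.
move=> I s t st tI; rewrite lt_min => /andP[sd sd'].
rewrite [ltRHS]splitr; apply: le_lt_trans (ltrD (df _ _ _ st tI sd) (dg _ _ _ st tI sd')).
rewrite -big_split/=; apply: ler_sum => i _ /=.
by rewrite opprD addrACA; exact: ler_normD.
Qed.

Lemma real_acN a b f : real_ac a b f -> real_ac a b (\- f).
Proof.
move=> acf e /acf[d d0 df]; exists d => // I s t st tI sd.
rewrite (le_lt_trans _ (df _ _ _ st tI sd))//; apply: ler_sum => i _ /=.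
by rewrite -opprD normrN.
Qed.

Lemma real_ac_sub a b c d f : a <= c -> d <= b -> real_ac a b f ->
  real_ac c d f.
Proof.
move=> ac db acf e /acf[r r0 rf]; exists r => // I s t st.
by apply: rf => i; have [? [? ?]] := st i; split; [|split]; lra.
Qed.

Lemma real_ac_small_oscillation a b f : real_ac a b f ->
  forall e : R, 0 < e -> exists2 d : R, 0 < d &
  forall x y, a <= x -> x <= y -> y <= b -> y - x < d -> `|f y - f x| < e.
Proof.
move=> acf e /acf[d d0 df]; exists d => // x y ax xy yb yxd.
have := df unit (fun=> x) (fun=> y); rewrite !big_const/= !card_unit/= !addr0.
by apply => // -[] [].
Qed.

(** The subintervals of all the partitions [l i] form a single disjoint family with the same total
    length, so the [d] of absolute continuity serves unchanged. *)
Lemma real_ac_variation a b f : real_ac a b f ->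
  forall e : R, 0 < e -> exists2 d : R, 0 < d &
  forall (I : finType) (s t : I -> R) (l : I -> seq R),
      (forall i, a <= s i /\ s i <= t i /\ t i <= b) ->
      trivIset [set: I] (fun i => `]s i, t i[%classic) ->
      (forall i, itv_partition (s i) (t i) (l i)) ->
      \sum_i (t i - s i) < d ->
      \sum_i variation (s i) (t i) f (l i) < e.
Proof.
move=> acf e /acf[d d0 df]; exists d => // I s t l stab tI lst sd.
(* A member of [J] is one step of one partition, with endpoints [S] and [T]. The list [l i] omits
   the left endpoint [s i], hence the cons; every index is in range, so the default of [nth] is
   never reached. *)
pose J := {i : I & 'I_(size (l i))}.
pose S (j : J) := nth (t (tag j)) (s (tag j) :: l (tag j)) (tagged j).
pose T (j : J) := nth (t (tag j)) (s (tag j) :: l (tag j)) (tagged j).+1.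
have nthmono i m n : (m <= n)%N -> (n <= size (l i))%N ->
    nth (t i) (s i :: l i) m <= nth (t i) (s i :: l i) n.
  move=> mn ni; have [+ _] := lst i; rewrite (@path_sortedE _ <%R (@lt_trans _ _)).
  move=> /andP[al sl].
  have sl' : sorted <=%R (s i :: l i).
    by rewrite /= path_sortedE ?(sub_all _ al) ?(sub_sorted _ sl)//;
      [move=> ? ? /ltW|move=> ? /ltW|exact: le_trans].
  by apply: (sorted_leq_nth (@le_trans _ _) (@lexx _ _)) => //; rewrite inE/= ltnS// (leq_trans mn).
have nthsize i : nth (t i) (s i :: l i) (size (l i)) = t i.
  have [_ /eqP tE] := lst i; rewrite -[RHS]tE.
  by rewrite (last_nth (t i)).
have ST j : s (tag j) <= S j /\ S j <= T j /\ T j <= t (tag j).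
  split; first by apply: (nthmono (tag j) 0%N) => //; exact: ltnW.
  split; first by apply: nthmono.
  by rewrite -[leRHS]nthsize; apply: nthmono.
have -> : \sum_i variation (s i) (t i) f (l i) = \sum_j `|f (T j) - f (S j)|.
  rewrite /variation; under eq_bigr do rewrite big_mkord.
  by rewrite sig_big_dep.
apply: df.
- move=> j; have [? [? ?]] := ST j; have [? [? ?]] := stab (tag j).
  by split; [|split]; lra.
- move=> [i m] [j n] _ _ /=; rewrite /S /T /= => -[x []]/=.
  (* A common point of two steps lies in both surrounding intervals, which forces [i = j]; within
     one partition, the earlier step ends before the later one begins. *)
  have := ST (Tagged (fun i => 'I_(size (l i))) m).
  have := ST (Tagged (fun i => 'I_(size (l i))) n).
  rewrite /S /T /= => -[n1 [n2 n3]] [m1 [m2 m3]].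
  rewrite !in_itv/= => /andP[x1 x2] /andP[x3 x4].
  have ij : i = j.
    by apply: tI => //; exists x; split => /=; rewrite in_itv/=; apply/andP; split; lra.
  subst j; congr existT; apply: val_inj.
  have [mn|nm|//] := ltngtP m n.
    by have := le_lt_trans (nthmono i _ _ mn (ltnW (ltn_ord n))) (lt_trans x3 x2); rewrite ltxx.
  by have := le_lt_trans (nthmono i _ _ nm (ltnW (ltn_ord m))) (lt_trans x1 x4); rewrite ltxx.
- apply: le_lt_trans sd.
  have -> : \sum_j (T j - S j) = \sum_i \sum_(m < size (l i))
      (nth (t i) (s i :: l i) m.+1 - nth (t i) (s i :: l i) m).
    by rewrite sig_big_dep.
  apply: ler_sum => i _; rewrite -(big_mkord xpredT
    (fun m => nth (t i) (s i :: l i) m.+1 - nth (t i) (s i :: l i) m)).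
  by rewrite telescope_sumr// nthsize.
Qed.

End real_ac.

(** * The total variation function *)

Section total_variation_ac.
Context (R : realType).
Implicit Types (a b : R) (f g : R -> R).

(** Intervals shorter than the [d] that belongs to the tolerance 1 have variation at most 1, and
    finitely many of them make up [[a, b]]. *)
Lemma real_ac_bounded_variation a b f : a <= b -> real_ac a b f ->
  bounded_variation a b f.
Proof.
move=> ab /real_ac_variation/(_ _ ltr01)[d d0 df].
have tv1 x y : a <= x -> x <= y -> y <= b -> y - x < d ->
    total_variation x y f \is a fin_num.
  move=> ax xy yb yxd; apply/bounded_variationP => //.
  exists 1 => _ [l xyl <-]; apply/ltW.
  have := df unit (fun=> x) (fun=> y) (fun=> l).
  by rewrite !big_const/= !card_unit/= !addr0; apply => // -[] [].
have h0 : 0 < d / 2 by rewrite divr_gt0.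
have tvn n : forall x, a <= x -> x <= b -> x <= a + (d / 2) *+ n ->
    total_variation a x f \is a fin_num.
  elim: n => [x ax xb|n ih x ax xb].
    rewrite mulr0n addr0 => xa; have -> : x = a by apply/le_anti/andP.
    by rewrite total_variationxx.
  (* The point [y] lies [d / 2] before [x], or at [a] if that would leave the interval; so [[y, x]]
     is short and the induction hypothesis applies to [[a, y]]. *)
  rewrite mulrSr => xn; pose y := Num.max a (x - d / 2).
  have ay : a <= y by rewrite le_max lexx.
  have yx : y <= x by rewrite ge_max; apply/andP; split; lra.
  have xyd : x - y < d.
    have : x - d / 2 <= y by rewrite le_max lexx orbT.
    by lra.
  rewrite (total_variationD _ ay yx) fin_numD (tv1 y x)// andbT.
  apply: ih => //; first by lra.
  rewrite ge_max; apply/andP; split; last by lra.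
  by rewrite lerDl mulrn_wge0// ltW.
apply/bounded_variationP => //.
apply: (tvn (Num.truncn ((b - a) / (d / 2))).+1) => //.
rewrite -lerBlDl -mulr_natr mulrC -ler_pdivrMr//; apply: ltW; exact: truncnS_gt.
Qed.

Definition tv_fun a f (x : R) : R := fine (total_variation a x f).

Lemma tv_funB a b f x y : bounded_variation a b f -> a <= x -> x <= y ->
  y <= b -> (tv_fun a f y - tv_fun a f x)%:E = total_variation x y f.
Proof.
move=> bv ax xy yb; rewrite /tv_fun (total_variationD f ax xy).
have fx : total_variation a x f \is a fin_num.
  by apply/bounded_variationP => //; apply: bounded_variationl bv => //; lra.
have fy : total_variation x y f \is a fin_num.
  apply/bounded_variationP => //; apply: (bounded_variationl xy yb).
  by apply: bounded_variationr bv => //; lra.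
by rewrite fineD// addrAC subrr add0r fineK.
Qed.

Lemma ler_tv_fun a b f x y : bounded_variation a b f -> a <= x -> x <= y ->
  y <= b -> `|f y - f x| <= tv_fun a f y - tv_fun a f x.
Proof.
by move=> bv ax xy yb; rewrite -lee_fin (tv_funB bv)// total_variation_ge.
Qed.

(** On each interval some partition almost attains the total variation, and [real_ac_variation]
    bounds the sum over all these partitions. *)
Lemma real_ac_tv_fun a b f : a <= b -> real_ac a b f ->
  real_ac a b (tv_fun a f).
Proof.
move=> ab acf; have bv := real_ac_bounded_variation ab acf.
move=> e e0; have e20 : 0 < e / 2 by rewrite divr_gt0.
have [d d0 df] := real_ac_variation acf e20; exists d => // I s t st tI sd.
(* The errors [eta], one for each interval, add up to at most [e / 2]; the successor keeps the
   denominator positive for an empty [I]. *)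
pose eta := e / 2 / #|I|.+1%:R.
have eta0 : 0 < eta by rewrite divr_gt0.
have /choice[l lP] : forall i, exists l, itv_partition (s i) (t i) l /\
    tv_fun a f (t i) - tv_fun a f (s i) < variation (s i) (t i) f l + eta.
  move=> i; have [asi [sti tbi]] := st i.
  have fin : total_variation (s i) (t i) f \is a fin_num by rewrite -(tv_funB bv).
  have [_ [_ [l stl <-] <-]] := ub_ereal_sup_adherent eta0 fin.
  rewrite -/(total_variation _ _ _) -(tv_funB bv)// -EFinB lte_fin => H.
  by exists l; split => //; lra.
have := df I s t l st tI (fun i => (lP i).1) sd.
move=> H; apply: (@le_lt_trans _ _ (\sum_i (variation (s i) (t i) f (l i) + eta))).
  apply: ler_sum => i _; have [asi [sti tbi]] := st i.
  rewrite ger0_norm; first exact: ltW (lP i).2.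
  by rewrite (le_trans _ (ler_tv_fun bv asi sti tbi)).
rewrite big_split/= sumr_const [ltRHS]splitr ltr_leD//.
rewrite -[leLHS]mulr_natr /eta -[leLHS]mulrA ler_piMr//; first exact: ltW.
by rewrite mulrC ler_pdivrMr// mul1r ler_nat leqW// max_card.
Qed.

End total_variation_ac.

Section stieltjes.
Context (R : realType).
Implicit Types (a b : R) (f g : R -> R).

(* Composing with [clamp a b] extends a function on [[a, b]] by constants, so that
   it has a Stieltjes measure on the line. *)
Definition clamp a b (x : R) := Num.max a (Num.min x b).

Lemma clamp_id a b x : a <= x <= b -> clamp a b x = x.
Proof. by move=> /andP[ax xb]; rewrite /clamp min_l// max_r. Qed.

Lemma clamp_itv a b x : a <= b -> a <= clamp a b x <= b.
Proof. by move=> ab; rewrite /clamp le_max lexx/= ge_max ab ge_min lexx orbT. Qed.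

Lemma le_clamp a b : {homo clamp a b : x y / x <= y}.
Proof.
move=> x y xy; rewrite /clamp ge_max le_max lexx/= le_max le_min !ge_min xy lexx.
by rewrite !orbT.
Qed.

Lemma ler_clampB a b x y : a <= b -> x <= y -> clamp a b y - clamp a b x <= y - x.
Proof.
move=> ab xy; rewrite /clamp; have [xb|bx] := leP x b; have [yb|yb] := leP y b.
- by have [?|?] := leP a x; have [?|?] := leP a y; lra.
- by have [?|?] := leP a x; have [?|?] := leP a b; lra.
- by have [?|?] := leP a b; have [?|?] := leP a y; lra.
- by have [?|?] := leP a b; lra.
Qed.

Lemma clamp_oo_sub a b x y : a <= b ->
  `]clamp a b x, clamp a b y[%classic `<=` `]x, y[%classic.
Proof.
move=> ab z; rewrite /= !in_itv/= /clamp gt_max lt_max => /andP[/andP[az +] +].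
rewrite gt_min lt_min => /orP[xz|bz] /orP[za|/andP[zy zb]]; apply/andP; split => //; lra.
Qed.

End stieltjes.

(** * Densities of absolutely continuous functions *)

Section stieltjes_domination.
Context {R : realType}.
Local Open Scope ereal_scope.
Local Notation mu := (@lebesgue_measure R).

(** One decomposition of [U] into disjoint half-open intervals serves all [F] at once. This allows a
    comparison of the Lebesgue measure of [U], where [F] is the identity, with its other Stieltjes
    measures. *)
Lemma stieltjes_ringE (U : set R) : measurable (U : set (SetRing.type (ocitv_type R))) ->
  exists (I : finType) (s t : I -> R), [/\ forall i, (s i <= t i)%R,
   trivIset [set: I] (fun i => `]s i, t i[%classic) &
   forall F : cumulative R R,
     lebesgue_stieltjes_measure F U = (\sum_i (F (t i) - F (s i))%R)%:E].
Proof.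
move=> mU.
pose D := fset_set (SetRing.decomp (U : set (SetRing.type (ocitv_type R)))).
have inD X : X \in D -> SetRing.decomp (U : set (SetRing.type (ocitv_type R))) X.
  by rewrite in_fset_set ?inE; [move=> /set_mem|exact: SetRing.decomp_finite_set].
have /choice[st stP] : forall X : D, exists st : R * R, (st.1 <= st.2)%R /\
    val X = `]st.1, st.2]%classic.
  move=> [X /= XD]; have /ocitvP : ocitv X.
    by apply: (SetRing.decomp_measurable mU); apply/mem_set; exact: inD.
  move=> [->|[x x12 ->]]; last by exists x; split => //; exact: ltW.
  (* The empty set is written as a degenerate interval. *)
  by exists (0, 0)%R; rewrite /= set_itv_ge// bnd_simp ltxx.
exists D, (fst \o st), (snd \o st); split.
- by move=> X; exact: (stP X).1.
- move=> X Y _ _ [z [/= zX zY]]; apply: val_inj.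
  apply: (@SetRing.decomp_triv _ _ (U : set (SetRing.type (ocitv_type R)))).
  + exact/inD/valP.
  + exact/inD/valP.
  + exists z; rewrite /= (stP X).2 (stP Y).2; split => /=.
      by move: zX; rewrite !in_itv/= => /andP[-> /ltW].
    by move: zY; rewrite !in_itv/= => /andP[-> /ltW].
- move=> F; rewrite /lebesgue_stieltjes_measure /measure_extension.
  rewrite measurable_Rmu_extE// /SetRing.measure fsbig_finite/=; last first.
    exact: SetRing.decomp_finite_set.
  rewrite -/D big_seq_fsetE/= -sumEFin; apply: eq_bigr => X _.
  by rewrite (stP X).2 wlength_itv_bnd// (stP X).1.
Qed.

(** A null set is covered by half-open intervals [A i] of total length below [d]. They may overlap,
    so the finite unions [U n] are decomposed into disjoint intervals; each [U n] has Stieltjes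
    measure at most [e], and so has their increasing union. *)
Lemma stieltjes_dominated (F : cumulative R R) :
  (forall e : R, 0 < e -> exists2 d : R, 0 < d &
    forall (I : finType) (s t : I -> R), (forall i, s i <= t i) ->
      trivIset [set: I] (fun i => `]s i, t i[%classic) ->
      \sum_i (t i - s i) < d -> \sum_i (F (t i) - F (s i)) < e)%R ->
  lebesgue_stieltjes_measure F `<< mu.
Proof.
move=> HF; apply/null_content_dominatesP => N mN N0.
apply/eqP; rewrite eq_le measure_ge0 andbT; apply/lee_addgt0Pr => e e0.
rewrite add0e; have [d d0 dF] := HF _ e0.
have : mu N < d%:E by rewrite N0 lte_fin.
move/ereal_inf_lt => [_ [A [mA NA] <-] Ad].
pose U n := \big[setU/set0]_(i < n) A i.
have rU n : measurable (U n : set (SetRing.type (ocitv_type R))).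
  by apply: bigsetU_measurable => i _; apply: SetRing.measurable_subring; exact: mA.
have mA' i : measurable (A i : set R).
  by apply: sub_sigma_algebra; exact: mA.
have mU n : measurable (U n : set R).
  by apply: bigsetU_measurable => i _; exact: mA'.
have Ue n : lebesgue_stieltjes_measure F (U n) <= e%:E.
  have [I [s [t [st tI UE]]]] := stieltjes_ringE (rU n).
  rewrite UE lee_fin; apply/ltW/dF => //.
  (* The Lebesgue measure is the Stieltjes measure of the identity, and [A] is one of the covers of
     [U n] in the infimum that defines it. *)
  rewrite -lte_fin; have := UE idfun; rewrite -/(lebesgue_measure _) => <-.
  apply: le_lt_trans Ad.
  apply: ereal_inf_lbound; exists A => //; split => //.
  by rewrite /U -bigcup_mkord; by move=> x [k _ Akx]; exists k.
have mUU : measurable (\bigcup_n (U n : set R)) by exact: bigcup_measurable.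
have cvU : lebesgue_stieltjes_measure F (U n) @[n --> \oo] -->
    lebesgue_stieltjes_measure F (\bigcup_n U n).
  apply: nondecreasing_cvg_mu => //.
  by move=> m n mn; apply/subsetPset; exact: subset_bigsetU.
apply: (@le_trans _ _ (lebesgue_stieltjes_measure F (\bigcup_n U n))).
  apply: (@le_measure _ _ _ (lebesgue_stieltjes_measure F)); [exact/mem_set|exact/mem_set|].
  apply: (subset_trans NA) => x [k _ Akx]; exists k.+1 => //.
  by rewrite /U big_ord_recr/=; right.
rewrite -(cvg_lim _ cvU)//; apply: lime_le; first by apply/cvg_ex; eexists; exact: cvU.
exact: nearW.
Qed.
End stieltjes_domination.

Section ac_density.
Context {R : realType}.
Implicit Types (a b x : R) (f g : R -> R).
Local Notation mu := (@lebesgue_measure R).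

Let stieltjes_itv (F : cumulative R R) (a b : R) : a <= b ->
  lebesgue_stieltjes_measure F `]a, b]%classic = (F b - F a)%:E.
Proof.
move=> ab; rewrite /lebesgue_stieltjes_measure /measure_extension.
by rewrite measurable_mu_extE/=; [rewrite wlength_itv_bnd|exact: is_ocitv].
Qed.

(** The extension of [f] by constants has a Stieltjes measure dominated by the Lebesgue measure; [g]
    is its Radon-Nikodym density. *)
Lemma nondecreasing_ac_density a b f : a <= b -> real_ac a b f ->
  {in `[a, b] &, nondecreasing_fun f} ->
  exists g, mu.-integrable [set: R] (EFin \o g) /\
    forall x, a <= x <= b -> f x - f a = \int[mu]_(t in `]a, x]) g t.
Proof.
move=> ab acf ndf; pose G := f \o clamp a b.
have ndG : nondecreasing G.
  by move=> x y xy; apply: ndf; rewrite ?in_itv/= ?clamp_itv//; exact: le_clamp.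
have cG : continuous (G : R -> R).
  move=> x; apply/cvgrPdist_lt => e e0.
  have [d d0 df] := real_ac_small_oscillation acf e0.
  near=> y; have yxd : `|x - y| < d by near: y; apply: cvgr_dist_lt => //; exact: cvg_id.
  have H u v : u <= v -> v - u < d -> `|G v - G u| < e.
    move=> uv vud; apply: df; rewrite ?le_clamp//.
    - by have /andP[] := clamp_itv u ab.
    - by have /andP[] := clamp_itv v ab.
    - exact: le_lt_trans (ler_clampB ab uv) vud.
  have [xy|yx] := leP x y.
    by rewrite distrC H//; rewrite distrC ger0_norm ?subr_ge0// in yxd.
  by rewrite H ?ltW//; rewrite ger0_norm ?subr_ge0 ?ltW// in yxd.
pose F : cumulative R R := HB.pack G
  (isCumulative.Build R _ R G ndG (right_continuousW cG)).
have Fmu : lebesgue_stieltjes_measure F `<< mu.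
  apply: stieltjes_dominated => e e0; have [d d0 df] := acf _ e0.
  exists d => // I s t st tI sd.
  have -> : \sum_i (F (t i) - F (s i)) =
      \sum_i `|f (clamp a b (t i)) - f (clamp a b (s i))|.
    apply: eq_bigr => i _; rewrite ger0_norm// subr_ge0; exact (ndG _ _ (st i)).
  apply: (df _ (clamp a b \o s) (clamp a b \o t)).
  - move=> i /=; have /andP[-> _] := clamp_itv (s i) ab.
    by have /andP[_ ->] := clamp_itv (t i) ab; split => //; split => //; exact: le_clamp.
  - move=> i j _ _ [x [/= xi xj]]; apply: tI => //; exists x.
    by split; [exact: clamp_oo_sub xi|exact: clamp_oo_sub xj].
  - by apply: le_lt_trans sd; apply: ler_sum => i _; exact: ler_clampB.
have mD : measurable (`]a, b]%classic : set (measurableTypeR R)) by exact: measurable_itv.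
have Dfin : (lebesgue_stieltjes_measure F `]a, b]%classic < +oo)%E.
  by rewrite stieltjes_itv// ltry.
(* Restricting to []a, b]] makes finiteness immediate, and with it the integrability of the
   density. *)
pose nu : {finite_measure set _ -> \bar R} := mfrestr mD Dfin.
have numu : nu `<< mu.
  apply/null_content_dominatesP => A mA A0.
  have mAD : measurable (A `&` `]a, b]%classic : set (measurableTypeR R)).
    exact: measurableI.
  have AD0 : mu (A `&` `]a, b]) = 0%E.
    apply/eqP; rewrite eq_le measure_ge0 andbT -A0.
    by apply: (@le_measure _ _ _ mu); [exact/mem_set|exact/mem_set|exact: subIsetl].
  exact: (null_content_dominatesP _ _).1 Fmu _ mAD AD0.
have [h [h0 hfin inth hE]] := radon_nikodym_sigma_finite numu.
have hfine : EFin \o (fine \o h) = h by apply/funext => x /=; rewrite fineK.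
exists (fine \o h); split; first by rewrite hfine.
move=> x /andP[ax xb]; apply: EFin_inj.
rewrite /Rintegral fineK; last first.
  apply: integrable_fin_num => //.
  suff : mu.-integrable `]a, x] (EFin \o (fine \o h)) by [].
  by rewrite hfine; apply: integrableS inth.
have -> : (\int[mu]_(t in `]a, x]) ((fine \o h) t)%:E = \int[mu]_(t in `]a, x]) h t)%E.
  by apply: eq_integral => y _ /=; rewrite fineK.
rewrite -hE// /nu/= /mfrestr /mrestr setIidl; last first.
  by apply: subset_itvl; rewrite bnd_simp.
by rewrite stieltjes_itv//= /G/= !clamp_id ?lexx ?ab ?ax.
Unshelve. all: by end_near. Qed.

(** [f] is the difference of [tv_fun a f] and [tv_fun a f \- f], which are both nondecreasing and
    absolutely continuous; their densities are subtracted. *)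
Lemma ac_density a b f : a <= b -> real_ac a b f ->
  exists g, mu.-integrable [set: R] (EFin \o g) /\
    forall x, a <= x <= b -> f x - f a = \int[mu]_(t in `]a, x]) g t.
Proof.
move=> ab acf; have bv := real_ac_bounded_variation ab acf.
have acV := real_ac_tv_fun ab acf.
have ndV : {in `[a, b] &, nondecreasing_fun (tv_fun a f)}.
  move=> x y; rewrite !in_itv/= => /andP[ax xb] /andP[ay yb] xy.
  by rewrite -subr_ge0 (le_trans _ (ler_tv_fun bv _ _ _)).
have ndW : {in `[a, b] &, nondecreasing_fun (tv_fun a f \- f)}.
  move=> x y; rewrite !in_itv/= => /andP[ax xb] /andP[ay yb] xy.
  have := le_trans (ler_norm _) (ler_tv_fun bv ax xy yb); lra.
have [g [intg gE]] := nondecreasing_ac_density ab acV ndV.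
have [h [inth hE]] := nondecreasing_ac_density ab (real_acD acV (real_acN acf)) ndW.
exists (g \- h); split; first exact: (integrableB measurableT intg inth).
move=> x xab; rewrite RintegralB//; last 2 first.
- exact: integrableS intg.
- exact: integrableS inth.
by rewrite -gE// -hE//=; lra.
Qed.

Lemma integral_ae_derivative a g : mu.-integrable [set: R] (EFin \o g) ->
  {ae mu, forall x, a < x ->
    derivable (fun x => \int[mu]_(t in `]a, x]) g t) x (1 : R) /\
    derive1 (fun x => \int[mu]_(t in `]a, x]) g t) x = g x}.
Proof.
move=> intg.
have locg : locally_integrable [set: R] g.
  by have := integrable_locally measurableT intg; rewrite patch_setT.
have intg' y : mu.-integrable [set` Interval (BRight a) (BRight y)] (EFin \o g).
  exact: integrableS intg.
have := FTC1 intg' locg.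
apply: filterS; first exact: (ae_filter_ringOfSetsType mu).
by move=> x H ax; exact: (H ax).
Qed.

(** Near an interior point [f] is the primitive of its density up to a constant, so the
    differentiation theorem identifies the density with the derivative. *)
Lemma ac_ae_derivative a b f : a <= b -> real_ac a b f ->
  exists g, [/\ mu.-integrable [set: R] (EFin \o g),
    forall x, a <= x <= b -> f x - f a = \int[mu]_(t in `]a, x]) g t &
    {ae mu, forall x, a < x < b -> derivable f x (1 : R) /\ derive1 f x = g x}].
Proof.
move=> ab acf; have [g [intg gE]] := ac_density ab acf; exists g; split => //.
have := integral_ae_derivative a intg.
apply: filterS; first exact: (ae_filter_ringOfSetsType mu).
move=> x /= H /andP[ax xb].
have [dx fx] := H ax.
pose F y := \int[mu]_(t in `]a, y]) g t + f a.
have Ff : {near x, F =1 f}.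
  near=> y; rewrite /F -gE ?subrK//; apply/andP; split; apply/ltW; near: y.
    exact: lt_nbhsr. exact: lt_nbhsl.
have dF : is_derive x (1 : R) F (g x).
  rewrite -[g x]addr0; apply: is_deriveD.
  apply: DeriveDef; first exact: dx.
  by rewrite -derive1E; exact: fx.
have := near_eq_is_derive Ff dF.
by move=> [? <-]; rewrite derive1E.
Unshelve. all: by end_near. Qed.

End ac_density.

(** * Almost everywhere estimates of Lp norms *)

Import HBNNSimple.

Section Lnorm_ae.
Context d (T : measurableType d) (R : realType).
Context (mu : {measure set T -> \bar R}).
Local Open Scope ereal_scope.

(* The library's comparison lemmas require measurability, which is not available
   for functions that are only almost everywhere equal to a measurable one. *)
Lemma ae_ge0_le_integral_nonmeasurable (f g : T -> \bar R) :
  (forall x, 0 <= f x) -> (forall x, 0 <= g x) ->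
  {ae mu, forall x, f x <= g x} ->
  \int[mu]_x f x <= \int[mu]_x g x.
Proof.
move=> f0 g0 [N [mN N0 fgN]]; rewrite !ge0_integralTE//.
apply: ge_ereal_sup => _ [h /= hf <-].
(* A simple function below [f] is cut down to the complement of the null set [N]. Its integral does
   not change, and it is now below [g] everywhere. *)
pose k := mul_nnsfun h (indic_nnsfun R (measurableC mN)).
have -> : sintegral mu h = sintegral mu k.
  rewrite -!integralT_nnsfun; apply: ae_eq_integral => //.
  - exact/measurable_EFinP.
  - exact/measurable_EFinP.
  exists N; split => // x /= /not_implyP[_]; apply: contra_notP => Nx.
  by rewrite /k/= mindicE mem_set ?mulr1.
apply: ereal_sup_ubound; exists k => //= x.
rewrite /k/= mindicE; have [/set_mem /= Nx|] := boolP (x \in ~` N); last by rewrite mulr0.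
rewrite mulr1 (le_trans (hf x))//.
by have [//|nfg] := pselect (f x <= g x); exfalso; apply/Nx/fgN.
Qed.

Lemma ae_le_Lnorm (p : \bar R) (f g : T -> R) : 1 <= p ->
  {ae mu, forall x, (`|f x| <= `|g x|)%R} ->
  Lnorm mu p (EFin \o f) <= Lnorm mu p (EFin \o g).
Proof.
case: p => [p||//]; last first.
  move=> _ fg; rewrite unlock; case: ifPn => // _.
  by apply: le_ess_sup; apply: filterS fg => x /=; rewrite lee_fin.
rewrite lee_fin => p1 fg; have p0 : (0 < p)%R by rewrite (lt_le_trans _ p1).
rewrite unlock; apply: gt0_ler_poweR.
- by rewrite invr_ge0 ltW.
- by rewrite in_itv/= leey andbT integral_ge0// => x _; exact: poweR_ge0.
- by rewrite in_itv/= leey andbT integral_ge0// => x _; exact: poweR_ge0.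
apply: ae_ge0_le_integral_nonmeasurable => [x|x|]; [exact: poweR_ge0|exact: poweR_ge0|].
apply: filterS fg => x /= fgx; rewrite lee_fin.
by rewrite ge0_ler_powR// ?nnegrE// ltW.
Qed.

Lemma LnormM (p : \bar R) (f : T -> R) (c : R) : 1 <= p -> (0 <= c)%R ->
  measurable_fun [set: T] f ->
  Lnorm mu p (EFin \o (fun x => c * f x)%R) = c%:E * Lnorm mu p (EFin \o f).
Proof.
case: p => [p||//]; last first.
  move=> _ c0 mf; rewrite unlock; case: ifPn => mu0; last by rewrite mule0.
  rewrite -ess_supZl//; apply/eq_ess_sup/nearW => t /=.
  by rewrite normrM (ger0_norm c0) EFinM.
rewrite lee_fin => p1 c0 mf; have p0 : (0 < p)%R by rewrite (lt_le_trans _ p1).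
rewrite unlock.
under eq_integral do rewrite /= normrM powRM// EFinM.
rewrite ge0_integralZl//.
- rewrite poweRM ?lee_fin ?powR_ge0//; last first.
    by apply: integral_ge0 => x _; rewrite lee_fin powR_ge0.
  by rewrite poweR_EFin -powRrM mulfV ?gt_eqF// powRr1// ger0_norm.
- apply/measurable_EFinP; apply: (@measurableT_comp _ _ _ _ _ _ (@powR R ^~ p)) => //.
  exact: measurableT_comp.
Qed.

End Lnorm_ae.

(** * Absolutely continuous complex functions *)

Section real_ac_more.
Context (R : realType).
Implicit Types (a b : R) (f g : R -> R).

Lemma real_ac_bounded a b f : a <= b -> real_ac a b f ->
  exists2 M, 0 < M & forall x, a <= x <= b -> `|f x| <= M.
Proof.
move=> ab acf; have bv := real_ac_bounded_variation ab acf.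
exists (1 + `|f a| + (tv_fun a f b - tv_fun a f a)).
  have := le_trans (normr_ge0 _) (ler_tv_fun bv (lexx a) ab (lexx b)).
  by have := normr_ge0 (f a); lra.
move=> x /andP[ax xb].
have := ler_tv_fun bv (lexx a) ax xb.
have := le_trans (normr_ge0 _) (ler_tv_fun bv ax xb (lexx b)).
have := ler_normD (f a) (f x - f a); rewrite addrC subrK; lra.
Qed.

(** Common source of the closure under products, under inverses away from 0, and under changes
    outside [[a, b]]. *)
Lemma real_ac_le a b f g h (M : R) : 0 <= M ->
  (forall x y, a <= x -> x <= y -> y <= b ->
    `|h y - h x| <= M * (`|f y - f x| + `|g y - g x|)) ->
  real_ac a b f -> real_ac a b g -> real_ac a b h.
Proof.
move=> M0 hfg acf acg e e0.
(* [M] may be 0, so the tolerance is divided by [M + 1]. *)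
have M1 : 0 < M + 1 by rewrite ltr_wpDl.
have e20 : 0 < e / 2 / (M + 1) by rewrite !divr_gt0.
have [d d0 df] := acf _ e20; have [d' d'0 dg] := acg _ e20.
exists (Num.min d d'); first by rewrite lt_min d0.
move=> I s t st tI; rewrite lt_min => /andP[sd sd'].
have := ltrD (df _ _ _ st tI sd) (dg _ _ _ st tI sd').
rewrite -mulrDl -splitr -big_split/= ltr_pdivlMr// mulrC; apply: le_lt_trans.
rewrite mulr_sumr; apply: ler_sum => i _; have [? [? ?]] := st i.
by rewrite (le_trans (hfg _ _ _ _ _))// ler_wpM2r ?addr_ge0// lerDl.
Qed.

Lemma real_acM a b f g : a <= b -> real_ac a b f -> real_ac a b g ->
  real_ac a b (f \* g).
Proof.
move=> ab acf acg; have [M M0 Mf] := real_ac_bounded ab acf.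
have [N N0 Ng] := real_ac_bounded ab acg.
apply: (@real_ac_le a b f g _ (M + N)) => //; first by rewrite addr_ge0// ltW.
move=> x y ax xy yb /=.
have -> : f y * g y - f x * g x = (f y - f x) * g y + f x * (g y - g x) by ring.
rewrite (le_trans (ler_normD _ _))// !normrM mulrDr lerD//.
  rewrite mulrC ler_wpM2r//; have := Ng y; lra.
rewrite ler_wpM2r//; have := Mf x; lra.
Qed.

Lemma real_ac_id a b : real_ac a b id.
Proof.
move=> e e0; exists e => // I s t st _; apply: le_lt_trans; apply: ler_sum => i _.
by rewrite ger0_norm// subr_ge0; have [? [? ?]] := st i.
Qed.

Lemma real_ac_cst a b c : real_ac a b (cst c).
Proof.
move=> e e0; exists e => // I s t st _ _; rewrite big1// => i _.
by rewrite /= subrr normr0.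
Qed.

Lemma real_ac_inv a b : 0 < a -> real_ac a b (fun x => x^-1).
Proof.
move=> a0; apply: (@real_ac_le a b id id _ (a^-1 ^+ 2)).
- by rewrite exprn_ge0// invr_ge0 ltW.
- move=> x y ax xy yb; have x0 : 0 < x by exact: lt_le_trans ax.
  have y0 : 0 < y by exact: lt_le_trans xy.
  have -> : y^-1 - x^-1 = - (x^-1 * y^-1 * (y - x)).
    by field; rewrite !gt_eqF.
  rewrite normrN normrM ler_pM//; last by rewrite lerDl.
  rewrite normrM expr2 ler_pM// gtr0_norm ?invr_gt0// lef_pV2// ?posrE//.
  exact: le_trans xy.
- exact: real_ac_id.
- exact: real_ac_id.
Qed.

Lemma real_ac_ext a b f g : (forall x, a <= x <= b -> f x = g x) ->
  real_ac a b f -> real_ac a b g.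
Proof.
move=> fg acf; apply: (@real_ac_le a b f f _ 1) => //.
move=> x y ax xy yb; rewrite -!fg ?ax ?xy ?(le_trans ax) ?(le_trans xy)//.
by rewrite mul1r lerDl.
Qed.

End real_ac_more.

Section lebesgue_ae.
Context {R : realType}.
Local Notation mu := (@lebesgue_measure R).

Lemma lebesgue_aeS (P Q : R -> Prop) : (forall x, P x -> Q x) ->
  {ae mu, forall x, P x} -> {ae mu, forall x, Q x}.
Proof. by move=> PQ; apply: filterS; first exact: (ae_filter_ringOfSetsType mu). Qed.

Lemma lebesgue_aeS2 (P Q S : R -> Prop) : (forall x, P x -> Q x -> S x) ->
  {ae mu, forall x, P x} -> {ae mu, forall x, Q x} -> {ae mu, forall x, S x}.
Proof. by move=> PQ; apply: filterS2; first exact: (ae_filter_ringOfSetsType mu). Qed.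

Lemma lebesgue_ae_neq (a : R) : {ae mu, forall x, x != a}.
Proof.
exists [set a]; split => //; first exact: lebesgue_measure_set1.
by move=> x /= /negP/negPn/eqP.
Qed.

Lemma lebesgue_ae_itvcc (a b : R) (P : R -> Prop) :
  {ae mu, forall x, a < x < b -> P x} -> {ae mu, forall x, `[a, b]%classic x -> P x}.
Proof.
move=> aeP.
have aeab : {ae mu, forall x, x != a /\ x != b}.
  by apply: lebesgue_aeS2 (lebesgue_ae_neq a) (lebesgue_ae_neq b).
apply: lebesgue_aeS2 aeP aeab => x Px [xa xb] /=; rewrite in_itv/= => /andP[ax bx].
by apply: Px; rewrite !lt_neqAle eq_sym xa ax xb bx.
Qed.

End lebesgue_ae.

Section complex_ac.
Context (R : realType).
Implicit Types (a b : R) (f g : R -> R[i]).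
Local Notation mu := (@lebesgue_measure R).

Lemma normc_ge0 (z : R[i]) : 0 <= normc z.
Proof. by case: z => x y; rewrite /normc sqrtr_ge0. Qed.

Lemma ler_Re_normc (z : R[i]) : `|complex.Re z| <= normc z.
Proof.
by case: z => x y; rewrite /normc/= -sqrtr_sqr ler_wsqrtr// lerDl sqr_ge0.
Qed.

Lemma ler_Im_normc (z : R[i]) : `|complex.Im z| <= normc z.
Proof.
by case: z => x y; rewrite /normc/= -sqrtr_sqr ler_wsqrtr// lerDr sqr_ge0.
Qed.

Lemma normc_ler (z : R[i]) : normc z <= `|complex.Re z| + `|complex.Im z|.
Proof.
case: z => x y; rewrite /normc/= -[leRHS]ger0_norm ?addr_ge0//.
rewrite -sqrtr_sqr ler_wsqrtr// sqrrD !real_normK ?num_real// -addrA lerD2l.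
by rewrite lerDr mulrn_wge0// mulr_ge0.
Qed.

Lemma normcR (x : R) : normc x%:C = `|x|.
Proof. by rewrite /normc/= expr0n/= addr0 sqrtr_sqr. Qed.

Lemma abs_continuousP a b f : abs_continuous a b f <->
  real_ac a b (@complex.Re R \o f) /\ real_ac a b (@complex.Im R \o f).
Proof.
split.
  move=> acf; split; apply: real_ac_of_ord => e /acf[d d0 df]; exists d => // n s t st tI sd;
    rewrite (le_lt_trans _ (df _ _ _ st tI sd))//; apply: ler_sum => i _ /=.
    by rewrite (le_trans _ (ler_Re_normc _)); case: (f (t i)) (f (s i)) => ? ? [].
  by rewrite (le_trans _ (ler_Im_normc _)); case: (f (t i)) (f (s i)) => ? ? [].
move=> [acr aci] e e0; have e20 : 0 < e / 2 by rewrite divr_gt0.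
have [d d0 df] := acr _ e20; have [d' d'0 dg] := aci _ e20.
exists (Num.min d d'); first by rewrite lt_min d0.
move=> n s t st tI; rewrite lt_min => /andP[sd sd'].
rewrite [ltRHS]splitr; apply: le_lt_trans (ltrD (df _ _ _ st tI sd) (dg _ _ _ st tI sd')).
rewrite -big_split/=; apply: ler_sum => i _.
by rewrite (le_trans (normc_ler _)); case: (f (t i)) (f (s i)) => ? ? [].
Qed.

Lemma abs_continuousM a b f g : a <= b -> abs_continuous a b f ->
  abs_continuous a b g -> abs_continuous a b (f \* g).
Proof.
move=> ab /abs_continuousP[fr fi] /abs_continuousP[gr gi]; apply/abs_continuousP.
split.
- have := real_acD (real_acM ab fr gr) (real_acN (real_acM ab fi gi)).
  by apply: real_ac_ext => x _ /=; case: (f x) (g x) => ? ? [].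
- have := real_acD (real_acM ab fr gi) (real_acM ab fi gr).
  by apply: real_ac_ext => x _ /=; case: (f x) (g x) => ? ? [].
Qed.

Lemma abs_continuous_real a b (f : R -> R) : real_ac a b f ->
  abs_continuous a b (fun x => (f x)%:C).
Proof. by move=> acf; apply/abs_continuousP; split => //; exact: real_ac_cst. Qed.

Lemma abs_continuous_sub a b c d f : a <= c -> d <= b ->
  abs_continuous a b f -> abs_continuous c d f.
Proof.
move=> ac db /abs_continuousP[fr fi]; apply/abs_continuousP.
by split; [exact: real_ac_sub fr|exact: real_ac_sub fi].
Qed.

Lemma abs_continuous_ext a b f g : (forall x, a <= x <= b -> f x = g x) ->
  abs_continuous a b f -> abs_continuous a b g.
Proof.
move=> fg /abs_continuousP[fr fi]; apply/abs_continuousP.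
by split; [apply: real_ac_ext fr|apply: real_ac_ext fi] => x /fg /= ->.
Qed.

Lemma abs_continuous_bounded a b f : a <= b -> abs_continuous a b f ->
  exists2 M, 0 < M & forall x, a <= x <= b -> normc (f x) <= M.
Proof.
move=> ab /abs_continuousP[fr fi]; have [M M0 Mf] := real_ac_bounded ab fr.
have [N N0 Nf] := real_ac_bounded ab fi; exists (M + N); first exact: addr_gt0.
move=> x xab; rewrite (le_trans (normc_ler _))// lerD//; [exact: Mf|exact: Nf].
Qed.

(** [cderive] is total, so the differentiability that the product rule requires is carried
    separately. *)
Definition cderivable f (x : R) := derivable (@complex.Re R \o f) x (1 : R) /\
  derivable (@complex.Im R \o f) x (1 : R).

Lemma derivable_is_derive1 (u : R -> R) (x : R) : derivable u x (1 : R) ->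
  is_derive x (1 : R) u (derive1 u x).
Proof. by move=> du; apply: DeriveDef; [exact: du|rewrite derive1E]. Qed.

(** With [c = -1] this is the real part of a complex product, with [c = 1] the imaginary part. *)
Lemma is_derive_mulD (u v w z : R -> R) (c x : R) :
  derivable u x (1 : R) -> derivable v x (1 : R) ->
  derivable w x (1 : R) -> derivable z x (1 : R) ->
  is_derive x (1 : R) (fun y => u y * v y + c * (w y * z y))
    (derive1 u x * v x + u x * derive1 v x +
     c * (derive1 w x * z x + w x * derive1 z x)).
Proof.
move=> du dv dw dz.
have Du := derivable_is_derive1 du.
have Dv := derivable_is_derive1 dv.
have Dw := derivable_is_derive1 dw.
have Dz := derivable_is_derive1 dz.
have Duv : is_derive x (1 : R) (fun y => u y * v y) (u x *: derive1 v x + v x *: derive1 u x).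
  exact: is_deriveM.
have Dwz : is_derive x (1 : R) (fun y => w y * z y) (w x *: derive1 z x + z x *: derive1 w x).
  exact: is_deriveM.
have Dcwz : is_derive x (1 : R) (fun y => c * (w y * z y))
    (c *: (w x *: derive1 z x + z x *: derive1 w x)).
  exact: is_deriveZ.
set h := (X in is_derive _ _ X _).
have -> : h = (fun y => u y * v y) + (fun y => c * (w y * z y)) by [].
apply: (is_derive_eq (is_deriveD Duv Dcwz)).
by rewrite /GRing.scale/=; ring.
Qed.

Lemma cderivableM f g x : cderivable f x -> cderivable g x ->
  cderivable (f \* g) x /\
  cderive (f \* g) x = cderive f x * g x + f x * cderive g x.
Proof.
move=> [fr fi] [gr gi].
have [dr vr] := is_derive_mulD (-1) fr gr fi gi.
have [di vi] := is_derive_mulD 1 fr gi fi gr.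
have Er : (fun y => complex.Re (f y * g y)) = fun y => (@complex.Re R \o f) y * (@complex.Re R \o g) y
   + -1 * ((@complex.Im R \o f) y * (@complex.Im R \o g) y).
  by apply/funext => y /=; rewrite mulN1r; case: (f y) (g y) => ? ? [].
have Ei : (fun y => complex.Im (f y * g y)) = fun y => (@complex.Re R \o f) y * (@complex.Im R \o g) y
   + 1 * ((@complex.Im R \o f) y * (@complex.Re R \o g) y).
  by apply/funext => y /=; rewrite mul1r; case: (f y) (g y) => ? ? [].
split; first by split; [rewrite -Er in dr|rewrite -Ei in di].
rewrite /cderive /= Er Ei [X in X +i* _]derive1E [X in _ +i* X]derive1E vr vi.
rewrite /comp; case: (f x) (g x) => f1 f2 [g1 g2] /=.
by apply/eqP; rewrite eq_complex/=; apply/andP; split; apply/eqP; ring.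
Qed.

Lemma abs_continuous_ae_derivative a b f : a <= b -> abs_continuous a b f ->
  exists k : R -> R[i],
   [/\ mu.-integrable [set: R] (EFin \o (@complex.Re R \o k)),
       mu.-integrable [set: R] (EFin \o (@complex.Im R \o k)),
       forall x, a <= x <= b ->
         complex.Re (f x) - complex.Re (f a) = \int[mu]_(t in `]a, x]) complex.Re (k t) /\
         complex.Im (f x) - complex.Im (f a) = \int[mu]_(t in `]a, x]) complex.Im (k t) &
       {ae mu, forall x, a < x < b -> cderivable f x /\ cderive f x = k x}].
Proof.
move=> ab /abs_continuousP[fr fi].
have [g [intg gE gd]] := ac_ae_derivative ab fr.
have [h [inth hE hd]] := ac_ae_derivative ab fi.
exists (fun x => g x +i* h x); split => //.
  by move=> x xab; split; [exact: gE|exact: hE].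
apply: lebesgue_aeS2 gd hd => x gx hx xab.
have [dr rE] := gx xab; have [di iE] := hx xab.
by split; [split|rewrite /cderive -rE -iE].
Qed.

End complex_ac.

(** * Norms and Hoelder's inequality on intervals *)

Section Lp_itv.
Context (R : realType).
Implicit Types (p : \bar R) (D : set R) (w : R -> R) (h k : R -> R[i]).
Local Notation mu := (@lebesgue_measure R).

Lemma lebesgue_measureT_gt0 : (0 < mu [set: R])%E.
Proof.
have : (mu `[0%R, 1%R]%classic <= mu [set: R])%E.
  have mI : measurable (`[0%R, 1%R]%classic : set (measurableTypeR R)).
    exact: measurable_itv.
  exact: (le_measure mu (mem_set mI) (mem_set measurableT) (@subsetT _ _)).
by apply: lt_le_trans; rewrite lebesgue_measure_itv/= lte_fin ltr01 oppr0 adde0 lte_fin.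
Qed.

(** Makes the exponent 1/p' a real number, equal to 0 for [p = 1] and to 1 for [p = +oo]. *)
Lemma fine_hoelder_conjugateV p : (1 <= p)%E ->
  fine ((hoelder_conjugate p)^-1)%E = 1 - fine (p^-1)%E.
Proof.
case: p => [p||//]; last by rewrite hoelder_conjugatey inve1 invey/= subr0.
rewrite lee_fin => p1; have p0 : p != 0 by rewrite gt_eqF// (lt_le_trans _ p1).
have := @hoelder_conjugate_eq1 _ p%:E; rewrite ltNyr eqe => /(_ isT p0).
rewrite inver (negbTE p0).
case: (_^-1)%E => [r||//] /=; last by rewrite addey.
by rewrite -EFinD => -[<-]; rewrite addrAC subrr add0r.
Qed.

Lemma Lnorm_indic (r : R) D : 0 < r -> measurable D ->
  Lnorm mu r%:E (EFin \o \1_D) = (mu D `^ r^-1)%E.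
Proof.
move=> r0 mD; rewrite unlock; congr (_ `^ _)%E.
rewrite -[X in _ = mu X]setIT -integral_indic//; apply: eq_integral => x _ /=.
by rewrite indicE; case: (_ \in _); rewrite ?normr1 ?normr0 ?powR1 ?powR0// gt_eqF.
Qed.

Lemma Lnorm_indic_itv_lty p a b : (1 <= p)%E ->
  (Lnorm mu p (EFin \o \1_`[a, b]%classic) < +oo)%E.
Proof.
case: p => [p||//]; last first.
  move=> _; rewrite unlock lebesgue_measureT_gt0.
  apply: (@le_lt_trans _ _ 1%E); last exact: ltry.
  apply/ess_supP/nearW => x /=; rewrite lee_fin indicE.
  by case: (_ \in _); rewrite ?normr1 ?normr0.
rewrite lee_fin => p1; rewrite Lnorm_indic ?(lt_le_trans _ p1)//.
apply: poweR_lty; rewrite lebesgue_measure_itv/=; case: ifP => _; last exact: ltry.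
by rewrite -EFinB ltry.
Qed.

(** Hoelder's inequality against the indicator of []0, t]], whose norm for the conjugate index is
    the power of [t]. For [p = 1] the indicator is bounded by 1; for [p = +oo] the function [w] is
    bounded almost everywhere by its norm. *)
Lemma hoelder_itv p w (t : R) : (1 <= p)%E -> measurable_fun [set: R] w -> 0 < t ->
  (Lnorm mu p (EFin \o w) < +oo)%E ->
  (\int[mu]_(x in `]0%R, t]) `|w x|%:E <=
   Lnorm mu p (EFin \o w) * (t `^ fine ((hoelder_conjugate p)^-1)%E)%:E)%E.
Proof.
move=> p1 mw t0 wfin; rewrite fine_hoelder_conjugateV//.
have -> : (\int[mu]_(x in `]0%R, t]) `|w x|%:E =
    Lnorm mu 1 (EFin \o (w \* \1_`]0%R, t]%classic)%R))%E.
  rewrite Lnorm1 [LHS]integral_mkcond; apply: eq_integral => x _ /=.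
  rewrite patchE indicE; case: ifPn => _; first by rewrite mulr1.
  by rewrite mulr0 normr0.
case: p p1 wfin => [p||//].
- rewrite lee_fin le_eqVlt => /predU1P[<- _|p1 wfin].
    rewrite inve1/= subrr powRr0 mule1.
    apply: ae_le_Lnorm => //; apply: nearW => x /=.
    by rewrite normrM ler_piMr// indicE; case: (_ \in _); rewrite ?normr1 ?normr0.
  have p0 : 0 < p by exact: lt_trans p1.
  rewrite inver gt_eqF//=; pose q := (1 - p^-1)^-1.
  have q0 : 0 < q by rewrite invr_gt0 subr_gt0 invf_lt1.
  have -> : (t `^ (1 - p^-1))%:E = Lnorm mu q%:E (EFin \o \1_`]0%R, t]%classic).
    rewrite Lnorm_indic// lebesgue_measure_itv/= lte_fin t0 oppr0 adde0 poweR_EFin.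
    by rewrite /q invrK.
  by apply: hoelder => //; rewrite /q invrK addrC subrK.
- move=> _ wfin; rewrite invey/= subr0 powRr1 ?(ltW t0)//.
  set M := Lnorm mu +oo (EFin \o w).
  have Mfin : M \is a fin_num by rewrite ge0_fin_numE// Lnorm_ge0.
  have wM : {ae mu, forall x, `|w x| <= fine M}.
    have := ess_sup_ge mu (abse \o (EFin \o w)).
    apply: lebesgue_aeS => x; rewrite /= -lee_fin fineK// /M unlock.
    by rewrite lebesgue_measureT_gt0.
  have M0 : 0 <= fine M by rewrite fine_ge0// Lnorm_ge0.
  apply: (@le_trans _ _ (Lnorm mu 1 (EFin \o (fun x => fine M * \1_`]0%R, t]%classic x)%R))).
    apply: ae_le_Lnorm => //; apply: lebesgue_aeS wM => x /= wx.
    by rewrite !normrM (ger0_norm M0) ler_wpM2r.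
  rewrite LnormM// fineK// Lnorm_indic// lebesgue_measure_itv/= lte_fin t0.
  by rewrite oppr0 adde0 poweR_EFin invr1 powRr1 ?(ltW t0).
Qed.

Lemma Lpnorm_ae_le p D h w : (1 <= p)%E ->
  {ae mu, forall x, D x -> normc (h x) <= `|w x|} ->
  (Lpnorm p D h <= Lnorm mu p (EFin \o w))%E.
Proof.
move=> p1 hw; apply: ae_le_Lnorm => //; apply: lebesgue_aeS hw => x hw.
rewrite normrM ger0_norm ?normc_ge0// indicE.
have [/set_mem xD|] := boolP (x \in D); last by rewrite normr0 mulr0.
by rewrite normr1 mulr1 hw.
Qed.

Lemma Lpnorm_ae_ge p D h w : (1 <= p)%E ->
  {ae mu, forall x, `|w x| <= normc (h x) * \1_D x} ->
  (Lnorm mu p (EFin \o w) <= Lpnorm p D h)%E.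
Proof.
move=> p1 hw; apply: ae_le_Lnorm => //; apply: lebesgue_aeS hw => x hw.
by rewrite (le_trans hw)// ler_norm.
Qed.

Lemma measurable_normc k : measurable_fun [set: R] (fun x => complex.Re (k x)) ->
  measurable_fun [set: R] (fun x => complex.Im (k x)) ->
  measurable_fun [set: R] (fun x => normc (k x)).
Proof.
move=> mr mi; rewrite (_ : (fun x => _) = (fun x => Num.sqrt
  (complex.Re (k x) ^+ 2 + complex.Im (k x) ^+ 2))); last first.
  by apply/funext => x; case: (k x).
apply: (measurableT_comp (continuous_measurable_fun (@sqrt_continuous R))).
by apply: measurable_funD; exact: measurable_funX.
Qed.

End Lp_itv.

(** * Absolutely continuous functions with derivative in L^p *)

Section AC_Lp.
Context (R : realType).
Implicit Types (p : \bar R) (D : set R) (w : R -> R) (f g h k : R -> R[i]).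
Local Notation mu := (@lebesgue_measure R).
Local Notation N p w := (Lnorm mu p (EFin \o w)).

Lemma Lnorm_lin_lty p (M M' : R) w w' : (1 <= p)%E -> 0 <= M -> 0 <= M' ->
  measurable_fun [set: R] w -> measurable_fun [set: R] w' ->
  (N p w < +oo)%E -> (N p w' < +oo)%E ->
  (N p (fun x => M * w x + M' * w' x)%R < +oo)%E.
Proof.
move=> p1 M0 M0' mw mw' wf wf'.
have mM (c : R) v : measurable_fun [set: R] v -> measurable_fun [set: R] (fun x => c * v x).
  by move=> mv; apply: measurable_funM => //.
apply: (le_lt_trans (eminkowski mu (mM M w mw) (mM M' w' mw') p1)).
by rewrite !LnormM//; apply: lte_add_pinfty; apply: lte_mul_pinfty => //; rewrite ?lee_fin.
Qed.

(** Replaces the derivative, which is meaningful only almost everywhere, by a Borel majorant [w] on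
    the whole line: the modulus of the density of [f], cut off outside [[a, b]]. *)
Lemma ac_derivative_bound p a b f : (1 <= p)%E -> a <= b -> abs_continuous a b f ->
  (Lpnorm p `[a, b] (cderive f) < +oo)%E ->
  exists w : R -> R, [/\ measurable_fun [set: R] w, (N p w < +oo)%E, forall x, 0 <= w x,
   (forall x, a <= x <= b ->
      ((normc (f x - f a))%:E <= 2%:E * \int[mu]_(t in `]a, x]) (w t)%:E)%E) &
   {ae mu, forall x, `[a, b]%classic x -> cderivable f x /\ normc (cderive f x) <= w x}].
Proof.
move=> p1 ab acf fin; have [k [intr inti kE kd]] := abs_continuous_ae_derivative ab acf.
have mr : measurable_fun [set: R] (fun x => complex.Re (k x)).
  by case/integrableP: intr => /measurable_EFinP.
have mi : measurable_fun [set: R] (fun x => complex.Im (k x)).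
  by case/integrableP: inti => /measurable_EFinP.
have mk := measurable_normc mr mi.
have {}kd := lebesgue_ae_itvcc kd.
exists (fun x => normc (k x) * \1_`[a, b] x); split.
- by apply: measurable_funM.
- apply: (le_lt_trans _ fin); apply: Lpnorm_ae_ge => //.
  apply: lebesgue_aeS kd => x H; rewrite normrM (ger0_norm (normc_ge0 _)) indicE.
  have [/set_mem/H[_ ->]|] := boolP (x \in _); first by rewrite normr1.
  by rewrite normr0 !mulr0.
- by move=> x; rewrite mulr_ge0 ?normc_ge0.
- move=> x /andP[ax xb]; have /kE[rE iE] : a <= x <= b by rewrite ax.
  have H (u : R -> R) : mu.-integrable [set: R] (EFin \o u) ->
      (forall t, `|u t| <= normc (k t)) ->
      ((`|\int[mu]_(t in `]a, x]) u t|)%:E <=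
        \int[mu]_(t in `]a, x]) (normc (k t) * \1_`[a, b] t)%:E)%E.
    move=> intu uk; have intu' : mu.-integrable `]a, x] (EFin \o u) by exact: integrableS intu.
    rewrite /Rintegral -fine_abse ?fineK; last 2 first.
    - by rewrite abse_fin_num integrable_fin_num.
    - exact: integrable_fin_num.
    apply: (le_trans (le_abse_integral mu _ _)) => //; first by case/integrableP: intu'.
    apply: ge0_le_integral => //.
    - by apply: measurableT_comp => //; case/integrableP: intu'.
    - by apply/measurable_EFinP; apply: measurable_funTS; exact: measurable_funM.
    - move=> t /=; rewrite in_itv/= => /andP[at0 tx]; rewrite lee_fin indicE mem_set ?mulr1//=.
      by rewrite in_itv/= (ltW at0) (le_trans tx).
  (* The factor 2 comes from estimating the real and imaginary parts separately. *)
  rewrite mule_natl mule2n; apply: le_trans (leeD (H _ intr _) (H _ inti _)).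
  - rewrite -EFinD lee_fin (le_trans (normc_ler _))// -rE -iE.
    by case: (f x) (f a) => ? ? [].
  - by move=> t; exact: ler_Re_normc.
  - by move=> t; exact: ler_Im_normc.
- apply: lebesgue_aeS kd => x H abx; have [dx <-] := H abx.
  by rewrite indicE mem_set// mulr1.
Qed.

Lemma in_Lp_cderive p a b f w : (1 <= p)%E -> a <= b -> abs_continuous a b f ->
  (N p w < +oo)%E ->
  {ae mu, forall x, `[a, b]%classic x -> normc (cderive f x) <= w x} ->
  in_Lp p `[a, b] (cderive f).
Proof.
move=> p1 ab acf wfin fw; split.
  have [k [intr inti kE kd]] := abs_continuous_ae_derivative ab acf.
  exists k; split.
  - by case/integrableP: intr => /measurable_EFinP.
  - by case/integrableP: inti => /measurable_EFinP.
  - by apply: lebesgue_aeS (lebesgue_ae_itvcc kd) => x H /H[].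
apply: le_lt_trans wfin; apply: Lpnorm_ae_le => //.
by apply: lebesgue_aeS fw => x H /H/le_trans; apply; exact: ler_norm.
Qed.

(** By the product rule the derivative is at most [M' * w x + M * v x], where [M] and [M'] bound [f]
    and [g]; Minkowski's inequality makes this finite in norm. *)
Lemma in_Lp_cderiveM p a b f g : (1 <= p)%E -> a <= b ->
  abs_continuous a b f -> abs_continuous a b g ->
  (Lpnorm p `[a, b] (cderive f) < +oo)%E -> (Lpnorm p `[a, b] (cderive g) < +oo)%E ->
  in_Lp p `[a, b] (cderive (f \* g)).
Proof.
move=> p1 ab acf acg ff gf.
have [w [mw wfin w0 _ fw]] := ac_derivative_bound p1 ab acf ff.
have [v [mv vfin v0 _ gv]] := ac_derivative_bound p1 ab acg gf.
have [M M0 fM] := abs_continuous_bounded ab acf.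
have [M' M0' gM] := abs_continuous_bounded ab acg.
apply: (@in_Lp_cderive _ _ _ _ (fun x => M' * w x + M * v x)) => //.
- exact: abs_continuousM.
- by apply: Lnorm_lin_lty => //; exact: ltW.
- apply: lebesgue_aeS2 fw gv => x fw gv abx.
  have [df dfw] := fw abx; have [dg dgv] := gv abx.
  have [_ ->] := cderivableM df dg.
  move: abx; rewrite /= in_itv/= => xab.
  rewrite (le_trans (le_normcD _ _))// !normcM lerD//.
    by rewrite mulrC ler_pM ?normc_ge0// gM.
  by rewrite ler_pM ?normc_ge0// fM.
Qed.

End AC_Lp.

(** * Extension by zero, and products in AC_p *)

Section valL0.
Context (R : realType).
Implicit Types (f g : unit_itv R -> R[i]).

Lemma valL0_val f (t : unit_itv R) : 'valL_0 f (val t) = f t.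
Proof. by have /(congr1 (fun F => F t)) := valLK (0 : R[i]) f. Qed.

Lemma valL0_out f x : ~ unit_itv R x -> 'valL_0 f x = 0.
Proof.
move=> xout; rewrite -(valLK (0 : R[i]) f).
rewrite -[LHS]/((valL_ (0 : R[i]) \o sigL (unit_itv R)) ('valL_0 f) x).
by rewrite sigLK /patch memNset.
Qed.

Lemma valL0_in f (F : R -> R[i]) : (forall t : unit_itv R, f t = F (val t)) ->
  forall x, 0 <= x <= 1 -> 'valL_0 f x = F x.
Proof.
move=> fF x x01; have xu : x \in unit_itv R by apply: mem_set; rewrite /unit_itv/= in_itv.
by have := valL0_val f (SigSub xu); rewrite fF.
Qed.

Lemma valL0M f g : 'valL_0 (f \* g) = 'valL_0 f \* 'valL_0 g.
Proof.
apply/funext => x; rewrite -[RHS]/('valL_0 f x * 'valL_0 g x).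
have [xu|xu] := pselect (unit_itv R x); last by rewrite !valL0_out// mulr0.
by have E h := valL0_val h (SigSub (mem_set xu)); rewrite !E.
Qed.

Lemma ACpM (p : \bar R) f g : (1 <= p)%E -> ACp p f -> ACp p g -> ACp p (f \* g).
Proof.
move=> p1 [acf f0 [_ ff]] [acg g0 [_ gf]]; split; rewrite valL0M.
- exact: abs_continuousM.
- by rewrite -[LHS]/('valL_0 f 0 * 'valL_0 g 0) f0 mul0r.
- exact: in_Lp_cderiveM.
Qed.

End valL0.

(** * Test functions *)

Section primitive.
Context (R : realType).
Implicit Types (a b c x : R) (u : R -> R).
Local Notation mu := (@lebesgue_measure R).

(** Absolute continuity of the integral, applied to the union [D] of the disjoint intervals. *)
Lemma real_ac_primitive c b u : mu.-integrable [set: R] (EFin \o u) ->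
  real_ac c b (fun x => \int[mu]_(t in `]c, x]) u t).
Proof.
move=> intu; apply: real_ac_of_ord => e /(integral_normr_continuous intu)[d [d0 du]].
exists d => // n s t st tI sd.
pose F i : set R := `]s i, t i[%classic.
pose D := \big[setU/set0]_(i < n) F i.
have mF i : measurable (F i) by exact: measurable_itv.
have mD : measurable D by exact: bigsetU_measurable.
have muD : (mu D < d%:E)%E.
  have -> : mu D = (\sum_(i < n) (t i - s i))%:E.
    rewrite [LHS](measure_bigsetU_ord mu xpredT mF tI) -sumEFin; apply: eq_bigr => i _.
    have [_ [sti _]] := st i.
    rewrite [LHS]lebesgue_measure_itv/= lte_fin; case: ltP => //.
    by move=> ts; congr EFin; lra.
  by rewrite lte_fin.
apply: le_lt_trans (du D mD muD).
have intn : mu.-integrable [set: R] (fun x => `|u x|%:E) by exact: (integrable_abse intu).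
have intnD A : measurable A -> mu.-integrable A (fun x => `|u x|%:E).
  by move=> mA; exact: integrableS intn.
rewrite -lee_fin /Rintegral fineK; last exact/integrable_fin_num/intnD.
rewrite ge0_integral_bigsetU//; last 3 first.
- exact: index_enum_uniq.
- by move=> i j _ _; exact: tI.
- by apply: measurable_int; exact: intnD.
rewrite -sumEFin; apply: lee_sum => i _; have [csi [sti _]] := st i.
(* The increment of the primitive is an integral over []s i, t i]]; dropping the endpoint does not
   change it. *)
rewrite -[X in (`|X|%R%:E <= _)%E](_ : \int[mu]_(x in `]s i, t i[) u x = _); last first.
  rewrite Rintegral_itv_bndo_bndc; last exact: integrableS intu.
  by rewrite Rintegral_itvB ?bnd_simp//; exact: integrableS intu.
rewrite (le_trans _ (_ : (\int[mu]_(x in F i) `|u x|)%:E <= _)%E)//.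
  by rewrite lee_fin le_normr_Rintegral//; exact: integrableS intu.
by rewrite /Rintegral fineK//; apply: integrable_fin_num; [exact: mF|exact: intnD (mF i)].
Qed.

End primitive.

Section test_density.
Context (R : realType).
Context (eps : nat -> R).
Context (eps01 : forall k, 0 < eps k <= 1).
Local Notation mu := (@lebesgue_measure R).
Local Notation N p w := (Lnorm mu p (EFin \o w)).

(* The integral of [U] is at most 1, so [U^(1/p)] has norm at most 1; on
   ]0, eps k] it is at least [(c k)^(1/p)]. *)
Let c k : R := (2 ^ k.+1)%:R^-1 / eps k.
Let U (x : R) : \bar R := (\sum_(k <oo) (c k * \1_`]0%R, eps k] x)%:E)%E.

Let eps0 k : 0 < eps k. Proof. by have /andP[] := eps01 k. Qed.

Let c0 k : 0 <= c k.
Proof. by rewrite divr_ge0// ltW. Qed.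

Let term_ge0 k x : (0 <= (c k * \1_`]0%R, eps k] x)%:E)%E.
Proof. by rewrite lee_fin mulr_ge0. Qed.

Let U0 x : (0 <= U x)%E.
Proof. exact: nneseries_ge0. Qed.

(** Only the [k] with [0 < x <= eps k] contribute. For these the inverse of [eps k] is at most that
    of [x], and the weights sum to 1. *)
Let Ufin x : U x \is a fin_num.
Proof.
rewrite ge0_fin_numE//; apply: (@le_lt_trans _ _ (`|x|^-1)%:E); last exact: ltry.
apply: le_trans (@epsilon_trick0 R `|x|^-1 xpredT _); last by rewrite invr_ge0.
apply: lee_nneseries => // k _; rewrite lee_fin indicE.
have [/set_mem|_] := boolP (x \in _); last by rewrite mulr0 mulr_ge0// invr_ge0.
rewrite /= in_itv/= => /andP[x0 xe]; rewrite mulr1 /c mulrC ler_wpM2r ?invr_ge0//.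
by rewrite gtr0_norm// lef_pV2 ?posrE.
Qed.

Let mU : measurable_fun [set: R] U.
Proof.
apply: ge0_emeasurable_sum => // k _.
by apply/measurable_EFinP; apply: measurable_funM.
Qed.

Let mue k : mu `]0, eps k]%classic = (eps k)%:E.
Proof. by rewrite lebesgue_measure_itv/= lte_fin eps0 oppr0 adde0. Qed.

Let intU : (\int[mu]_x U x <= 1)%E.
Proof.
rewrite integral_nneseries//; last first.
  by move=> k; apply/measurable_EFinP; apply: measurable_funM.
apply: le_trans (@epsilon_trick0 R 1 xpredT _); last by [].
apply: lee_nneseries => [k _ _|k _]; first exact: integral_ge0.
under eq_integral do rewrite EFinM.
rewrite ge0_integralZl//; last 2 first.
  by apply/measurable_EFinP; exact: measurable_indic.
  by rewrite lee_fin.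
rewrite integral_indic// setIT [X in (_ * X)%E]mue.
by rewrite -EFinM /c divfK ?gt_eqF// div1r.
Qed.

Let Uge k x : 0 < x <= eps k -> c k <= fine (U x).
Proof.
move=> xe; rewrite -lee_fin fineK//.
rewrite /U (@nneseriesD1 _ _ k)//; apply: le_trans (leeDl _ _); last first.
  exact: nneseries_ge0.
by rewrite indicE mem_set ?mulr1//= in_itv.
Qed.

(** For finite [p] the density is [U^(1/p)], whose integral over []0, eps k]] is at least
    [eps k * (c k)^(1/p)]. For [p = +oo] the indicator of [[0, 1]] suffices. *)
Lemma test_density_exists (p : \bar R) : (1 <= p)%E ->
  exists u : R -> R, [/\ measurable_fun [set: R] u,
    mu.-integrable [set: R] (EFin \o u), forall x, 0 <= u x, (N p u < +oo)%E &
    forall k, (2 ^ k.+1)%:R^-1 * eps k `^ fine ((hoelder_conjugate p)^-1)%E <=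
      \int[mu]_(x in `]0, eps k]) u x].
Proof.
move=> p1; rewrite fine_hoelder_conjugateV//; case: p p1 => [p||//]; last first.
  move=> _; exists \1_`[0%R, 1%R]%classic; split => //.
  - exact: integrable_indic_itv.
  - by apply: Lnorm_indic_itv_lty; rewrite leey.
  - move=> k; rewrite invey/= subr0 powRr1 ?(ltW (eps0 k))//.
    have -> : \int[mu]_(x in `]0, eps k]) \1_`[0%R, 1%R]%classic x = eps k.
      rewrite /Rintegral integral_indic// setIidr; last first.
        move=> x; rewrite /= !in_itv/= => /andP[x0 xe].
        by rewrite ltW//= (le_trans xe)//; have /andP[] := eps01 k.
      exact: (congr1 fine (mue k)).
    by rewrite ler_piMl ?(ltW (eps0 k))// invf_le1 ?ltr0n ?ler1n ?expn_gt0.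
rewrite lee_fin => p1; have p0 : 0 < p by exact: lt_le_trans p1.
have ip0 : p^-1 != 0 by rewrite invr_neq0// gt_eqF.
have mfU : measurable_fun [set: R] (fine \o U).
  by apply/measurable_EFinP; rewrite (_ : EFin \o _ = U)//; apply/funext => x /=; rewrite fineK.
pose u x := fine (U x) `^ p^-1.
have mu_u : measurable_fun [set: R] u by exact: (measurableT_comp (measurable_powR _)).
have u0 x : 0 <= u x by exact: powR_ge0.
have Nu : (N p%:E u < +oo)%E.
  rewrite unlock; apply: poweR_lty; apply: le_lt_trans (ltry 1); apply: le_trans intU.
  rewrite le_eqVlt; apply/orP; left; apply/eqP; apply: eq_integral => x _ /=.
  by rewrite ger0_norm// /u -powRrM mulVf ?gt_eqF// powRr1 ?fine_ge0// fineK.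
(* [u] vanishes outside []0, 1]], so its integrability follows from Hoelder's inequality on that
   interval. *)
have uout x : ~ `]0, 1]%classic x -> u x = 0.
  move=> x01; rewrite /u; have -> : U x = 0%E.
    rewrite /U eseries0// => k _ _; rewrite indicE memNset ?mulr0//.
    move: x01; apply: contra_not; rewrite /= !in_itv/= => /andP[-> xe]/=.
    by rewrite (le_trans xe)//; have /andP[] := eps01 k.
  by rewrite powR0.
have intu : mu.-integrable [set: R] (EFin \o u).
  apply/integrableP; split; first exact/measurable_EFinP.
  apply: (@le_lt_trans _ _ (\int[mu]_(x in `]0%R, 1%R]) `|u x|%:E)%E).
    rewrite [leRHS]integral_mkcond le_eqVlt; apply/orP; left; apply/eqP.
    apply: eq_integral => x _ /=; rewrite patchE.
    by case: ifPn => // /negP xn; rewrite uout ?normr0// => /mem_set.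
  apply: (le_lt_trans (hoelder_itv _ mu_u ltr01 Nu)) => //.
  by rewrite powR1 mule1.
exists u; split => // k; rewrite inver gt_eqF//=.
apply: (@le_trans _ _ (\int[mu]_(x in `]0, eps k]) cst (c k `^ p^-1) x)).
  rewrite Rintegral_cst// [X in _ <= _ * fine X]mue/=.
  rewrite /c powRM ?invr_ge0// ?(ltW (eps0 k))// -mulrA ler_pM ?powR_ge0//.
    (* A number in []0, 1]] is at most its power with exponent [p^-1 <= 1]. *)
    apply: ger1_powR; last by rewrite invf_le1.
    by rewrite invr_gt0 ltr0n expn_gt0/= invf_le1 ?ltr0n ?expn_gt0// ler1n expn_gt0.
  rewrite powRB; last by rewrite (gt_eqF (eps0 k)) implybT.
  rewrite powRr1 ?(ltW (eps0 k))// mulrC.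
  by rewrite -[(eps k)^-1]powR_inv1 ?(ltW (eps0 k))// -powRrM mulN1r powRN.
apply: le_Rintegral => //.
- apply/integrableP; split; first exact/measurable_EFinP/measurable_cst.
  rewrite [X in (X < _)%E](_ : _ =
    \int[mu]_(x in `]0%R, eps k]) cst `|c k `^ p^-1|%:E x)%E//.
  by rewrite integral_cst// [X in (_ * X < _)%E]mue -EFinM ltry.
- exact: integrableS intu.
- move=> x; rewrite /= in_itv/= => xe; apply: ge0_ler_powR; rewrite ?nnegrE ?invr_ge0 ?(ltW p0)//.
  + by rewrite fine_ge0.
  + exact: Uge.
Qed.

End test_density.

(** * Growth of the members of AC_p, and explicit members *)

Section ACp_functions.
Context (R : realType).
Context (p : \bar R).
Context (p1 : (1 <= p)%E).
Implicit Types (f g : unit_itv R -> R[i]) (x t : R) (u : R -> R).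
Local Notation mu := (@lebesgue_measure R).
Local Notation N w := (Lnorm mu p (EFin \o w)).
Local Notation kappa := (fine ((hoelder_conjugate p)^-1)%E).

(** Since [f] vanishes at 0, its value at [x] is controlled by the integral of [w] over []0, x]],
    and Hoelder's inequality yields the power of [x]. *)
Lemma ACp_derivative_bound f : ACp p f ->
  exists w : R -> R, [/\ measurable_fun [set: R] w, (N w < +oo)%E, forall x, 0 <= w x,
    forall x, 0 < x <= 1 ->
      ((normc ('valL_0 f x))%:E <= 2%:E * N w * (x `^ kappa)%:E)%E &
   {ae mu, forall x, `[0, 1]%classic x ->
      cderivable ('valL_0 f) x /\ normc (cderive ('valL_0 f) x) <= w x}].
Proof.
move=> [acf f0 [_ ff]].
have [w [mw wfin w0 fw dw]] := ac_derivative_bound p1 ler01 acf ff.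
exists w; split => // x /andP[x0 x1].
have := fw x; rewrite f0 subr0 (ltW x0) x1 => /(_ isT)/le_trans; apply.
rewrite -muleA lee_pmul2l// (le_trans _ (hoelder_itv p1 mw x0 wfin))//.
by rewrite le_eqVlt; apply/orP; left; apply/eqP; apply: eq_integral => t _; rewrite ger0_norm.
Qed.

Lemma ACp_primitive u : measurable_fun [set: R] u ->
  mu.-integrable [set: R] (EFin \o u) -> (forall x, 0 <= u x) ->
  (N u < +oo)%E ->
  ACp p (fun t : unit_itv R => (\int[mu]_(x in `]0, val t]) u x)%:C).
Proof.
move=> mu_u intu u0 Nu; pose G x := \int[mu]_(s in `]0, x]) u s.
set g := (X in ACp p X).
have gG x : 0 <= x <= 1 -> 'valL_0 g x = (G x)%:C by exact: (valL0_in (F := fun x => (G x)%:C)).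
have acg : abs_continuous 0 1 ('valL_0 g).
  apply: (@abs_continuous_ext _ _ _ (fun x => (G x)%:C)).
    by move=> x /gG.
  exact/abs_continuous_real/real_ac_primitive.
split => //.
  by rewrite gG ?lexx ?ler01// /G set_itvoc0 Rintegral_set0.
apply: (@in_Lp_cderive _ _ _ _ _ u) => //.
apply: lebesgue_ae_itvcc.
apply: lebesgue_aeS (integral_ae_derivative 0 intu) => x H /andP[x0 x1].
have [dG GE] := H x0.
(* The extension by 0 agrees with [G] on [[0, 1]], hence has the derivative of [G] at interior
   points. *)
have nG : \forall y \near x, 'valL_0 g y = (G y)%:C.
  near=> y; apply: gG; apply/andP; split; apply/ltW; near: y.
    exact: lt_nbhsr. exact: lt_nbhsl.
have -> : cderive ('valL_0 g) x = u x +i* 0.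
  rewrite /cderive; congr (_ +i* _).
    rewrite -GE !derive1E; apply: near_eq_derive.
    by apply: filterS nG => y ->.
  rewrite -(derive1_cst (0 : R) x) !derive1E; apply: near_eq_derive.
  by apply: filterS nG => y ->.
by rewrite normcR ger0_norm.
Unshelve. all: by end_near. Qed.

(** The primitive of a nonnegative density is nondecreasing, so its lower bound at [eps k] persists
    up to 1. *)
Lemma ACp_test (eps : nat -> R) : (forall k, 0 < eps k <= 1) ->
  exists G : R -> R, ACp p (fun t : unit_itv R => (G (val t))%:C) /\
    forall k t, eps k <= t <= 1 -> (2 ^ k.+1)%:R^-1 * eps k `^ kappa <= G t.
Proof.
move=> eps01; have [u [mu_u intu u0 Nu ue]] := test_density_exists eps01 p1.
exists (fun x => \int[mu]_(s in `]0, x]) u s); split; first exact: ACp_primitive.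
move=> k t /andP[et _]; apply: (le_trans (ue k)).
rewrite -subr_ge0 Rintegral_itvB; [|exact: integrableS intu|..].
- exact: Rintegral_ge0.
- by rewrite bnd_simp; have /andP[/ltW] := eps01 k.
- by rewrite bnd_simp.
Qed.

Definition unit_id (t : unit_itv R) : R[i] := (val t)%:C.

Lemma ACp_id : ACp p unit_id.
Proof.
(* The identity is the primitive of the indicator of [[0, 1]], which brings it under
   [ACp_primitive]. *)
have -> : unit_id = fun t : unit_itv R => (\int[mu]_(x in `]0, val t]) \1_`[0%R, 1%R]%classic x)%:C.
  apply/funext => t; congr (_%:C).
  have /set_mem := valP t; rewrite /unit_itv/= in_itv/= => /andP[t0 t1].
  rewrite /Rintegral integral_indic// setIidr; last first.
    by move=> x; rewrite /= !in_itv/= => /andP[/ltW -> /le_trans]; apply.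
  rewrite [X in fine X](_ : _ = (val t)%:E)// [LHS]lebesgue_measure_itv/= lte_fin oppr0 adde0.
  by case: ltP => // tle0; congr EFin; apply/le_anti; rewrite t0 tle0.
apply: ACp_primitive => //.
- exact: integrable_indic_itv.
- exact: Lnorm_indic_itv_lty.
Qed.

End ACp_functions.

(** Continuity at [x] follows from the small oscillation of [m] on [[x / 2, 1]]. *)
Lemma abs_continuous_within_continuous (R : realType) (m : R -> R[i]) :
  (forall eps : R, 0 < eps < 1 -> abs_continuous eps 1 m) ->
  {within `]0, 1], continuous (m : R -> R[i]^o)}.
Proof.
move=> acm; apply/subspace_continuousP => x /=; rewrite in_itv/= => /andP[x0 x1].
(* The tolerance is a positive complex number, and such a number is real. *)
apply/cvgrPdist_lt => e e0; have [e1 e1E] : exists e1 : R, e = e1%:C.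
  exists (complex.Re e); move: e0; rewrite ltcE /= => /andP[/eqP Im0 _].
  by rewrite [LHS]complexE Im0 mulr0 addr0.
move: e0; rewrite e1E ltcR => e10.
have e20 : 0 < e1 / 2 by rewrite divr_gt0.
have x20 : 0 < x / 2 < 1 by apply/andP; split; lra.
have /abs_continuousP[mr mi] := acm _ x20.
have [d d0 dr] := real_ac_small_oscillation mr e20.
have [d' d'0 di] := real_ac_small_oscillation mi e20.
have osc y z : x / 2 <= y -> y <= z -> z <= 1 -> z - y < Num.min d d' ->
    normc (m z - m y) < e1.
  move=> xy yz z1; rewrite lt_min => /andP[zd zd'].
  rewrite (le_lt_trans (normc_ler _))// [ltRHS]splitr.
  have := ltrD (dr _ _ xy yz z1 zd) (di _ _ xy yz z1 zd').
  by rewrite /=; case: (m z) (m y) => ? ? [].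
(* The bound [x / 2] keeps nearby points inside [[x / 2, 1]]. *)
have dmin : 0 < Num.min (Num.min d d') (x / 2) by rewrite !lt_min d0 d'0; lra.
rewrite near_withinE; near=> y => /=; rewrite in_itv/= => /andP[y0 y1].
have : `|x - y| < Num.min (Num.min d d') (x / 2).
  by near: y; apply: cvgr_dist_lt => //; exact: cvg_id.
rewrite lt_min => /andP[xyd xy2].
rewrite -[ltLHS]/((normc (m x - m y))%:C) ltcR.
have [xy|yx] := leP x y.
  rewrite -normcN opprB; apply: osc => //; first by lra.
  by rewrite distrC ger0_norm ?subr_ge0// in xyd.
rewrite gtr0_norm ?subr_gt0// in xyd xy2.
by apply: osc => //; [lra|exact: ltW].
Unshelve. all: by end_near. Qed.

Section inverse.
Context (R : realType).
Local Notation mu := (@lebesgue_measure R).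

Lemma abs_continuous_inv (eps : R) : 0 < eps ->
  abs_continuous eps 1 (fun t : R => (t^-1)%:C).
Proof. by move=> e0; exact/abs_continuous_real/real_ac_inv. Qed.

(** On [[eps, 1]] the derivative is bounded by [eps^-1 ^+ 2], and constants on a bounded interval
    have finite norm. *)
Lemma in_Lp_cderive_inv (p : \bar R) (eps : R) : (1 <= p)%E -> 0 < eps -> eps <= 1 ->
  in_Lp p `[eps, 1] (cderive (fun t : R => (t^-1)%:C)).
Proof.
move=> p1 e0 e1.
apply: (@in_Lp_cderive _ _ _ _ _ (fun x => eps^-1 ^+ 2 * \1_`[eps, 1]%classic x)) => //.
- exact: abs_continuous_inv.
- rewrite LnormM//; last by rewrite exprn_ge0// invr_ge0 ltW.
  by apply: lte_mul_pinfty; rewrite ?lee_fin ?exprn_ge0 ?invr_ge0 ?(ltW e0)//;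
    exact: Lnorm_indic_itv_lty.
- apply: nearW => x xe; rewrite indicE mem_set// mulr1.
  have /andP[ex x1] : eps <= x <= 1 by move: xe; rewrite /= in_itv.
  have x0 : 0 < x by exact: lt_le_trans ex.
  have dx : derive1 (fun y : R => y^-1) x = - x^-1 ^+ 2.
    rewrite derive1E.
    have := @is_deriveV R id x 1 1 (lt0r_neq0 x0) (is_derive_id _ _).
    by move=> [_ ->]; rewrite exprVn /GRing.scale/= mulr1.
  rewrite (_ : cderive _ x = (- x^-1 ^+ 2)%:C); last first.
    rewrite /cderive/= dx; congr (_ +i* _); exact: derive1_cst.
  rewrite normcR.
  rewrite normrN ger0_norm ?exprn_ge0 ?invr_ge0 ?(ltW x0)//.
  by rewrite lerXn2r ?nnegrE ?invr_ge0 ?(ltW x0) ?(ltW e0)// lef_pV2 ?posrE.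
Qed.
End inverse.

(** * Multipliers *)

Section multipliers.
Context (R : realType).
Context (p : \bar R).
Context (p1 : (1 <= p)%E).
Implicit Types (f g : unit_itv R -> R[i]) (x t : R) (m : R -> R[i]).
Local Notation mu := (@lebesgue_measure R).
Local Notation N w := (Lnorm mu p (EFin \o w)).
Local Notation kappa := (fine ((hoelder_conjugate p)^-1)%E).

Lemma mulfun_multiplier (T : {fun ACp (R := R) p >-> ACp (R := R) p}) m :
  (forall g, ACp p g -> T g = mulfun m g) -> multiplier T.
Proof.
move=> Tm f g fA gA.
rewrite (Tm _ (ACpM p1 fA gA)) (Tm _ fA) (Tm _ gA).
by split; apply/funext => t; rewrite /mulfun/=; case: ifP => _; rewrite ?mulr0 ?mul0r//;
  ring.
Qed.

(** Turns [mulfun] into a plain product, to which the product rule applies; at 0 both sides vanish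
    whatever [m 0] is. *)
Lemma valL0_mulfun m g : 'valL_0 g 0 = 0 ->
  'valL_0 (mulfun m g) = m \* 'valL_0 g.
Proof.
move=> g0; apply/funext => x; rewrite -[RHS]/(m x * 'valL_0 g x).
have [xu|xu] := pselect (unit_itv R x); last by rewrite !valL0_out// mulr0.
have E h := valL0_val h (SigSub (mem_set xu)); rewrite !E /mulfun /=.
by case: eqP => // x0; rewrite -(E g) -[\val _]/x [in RHS]x0 g0 mulr0.
Qed.

Lemma nat_not_bounded (C : R) : ~ (forall k : nat, k%:R <= C).
Proof. by move=> H; have := H (Num.truncn C).+1; rewrite leNgt truncnS_gt. Qed.

Section symbol.
Context (m : R -> R[i]).
Context (mA : forall g, ACp p g -> ACp p (mulfun m g)).

Let ACp0 g : ACp p g -> 'valL_0 g 0 = 0. Proof. by case. Qed.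

Lemma symbol_bounded : exists M : R, forall t, 0 < t <= 1 -> normc (m t) <= M.
Proof.
apply: contrapT => unbounded.
(* Failure of the bound [k * 2 ^ k.+1] supplies a point [e k] for each [k]; the power of 2
   compensates the loss in [ACp_test]. *)
have /choice[e eP] : forall k : nat, exists t, 0 < t <= 1 /\
    k%:R * (2 ^ k.+1)%:R < normc (m t).
  move=> k; apply: contrapT => nt; apply: unbounded.
  exists (k%:R * (2 ^ k.+1)%:R) => t t01; rewrite leNgt; apply/negP => mt.
  by apply: nt; exists t.
have [G [AG eG]] := ACp_test p1 (fun k => (eP k).1).
set g := (X in ACp p X) in AG.
have [w [mw wfin w0 wb _]] := ACp_derivative_bound p1 (mA AG).
have Nfin : N w \is a fin_num by rewrite ge0_fin_numE// Lnorm_ge0.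
apply: (@nat_not_bounded (2 * fine (N w))) => k.
have [t01 mt] := eP k; have /andP[t0 t1] := t01.
have := wb _ t01; rewrite valL0_mulfun; last exact: ACp0.
rewrite -[X in normc X]/(m (e k) * 'valL_0 g (e k)) normcM.
rewrite (valL0_in (F := fun x => (G x)%:C))//; last by rewrite (ltW t0).
rewrite normcR -(fineK Nfin) -!EFinM lee_fin.
have k0 : 0 < e k `^ kappa by exact: powR_gt0.
have Ge : (2 ^ k.+1)%:R^-1 * e k `^ kappa <= G (e k) by apply: eG; rewrite lexx.
have pw : 0 < (2 ^ k.+1)%:R :> R by rewrite ltr0n expn_gt0.
have G0 : 0 < G (e k) by apply: lt_le_trans Ge; rewrite mulr_gt0// invr_gt0.
rewrite gtr0_norm// => H.
(* The powers of 2 and of [e k] cancel, which bounds every [k] by one constant. *)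
have : k%:R * (2 ^ k.+1)%:R * ((2 ^ k.+1)%:R^-1 * e k `^ kappa) <= 2 * fine (N w) * e k `^ kappa.
  apply: le_trans H; by apply: ler_pM => //; [rewrite mulr_ge0 ?invr_ge0 ?powR_ge0|exact: ltW].
rewrite -mulrA (mulrA _ _^-1) mulfV ?gt_eqF// mul1r ler_pM2r//.
Qed.

Lemma symbol_derivative_bound :
  (forall eps, 0 < eps < 1 -> abs_continuous eps 1 m) ->
  exists A : R, forall eps : R, 0 < eps < 1 ->
    (Lpnorm p `[eps, 1%R] (cderive m) <= (A * eps `^ (- kappa))%R%:E)%E.
Proof.
move=> acm; have [M Mm] := symbol_bounded.
apply: contrapT => unbounded.
have /choice[e eP] : forall k : nat, exists t, 0 < t < 1 /\
    ((k%:R * (2 ^ k.+1)%:R * t `^ (- kappa))%R%:E < Lpnorm p `[t, 1%R] (cderive m))%E.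
  move=> k; apply: contrapT => nt; apply: unbounded.
  exists (k%:R * (2 ^ k.+1)%:R) => t t01; rewrite leNgt; apply/negP => mt.
  by apply: nt; exists t.
have e01 k : 0 < e k <= 1 by have [/andP[-> /ltW]] := eP k.
have [G [AG eG]] := ACp_test p1 e01.
set g := (X in ACp p X) in AG.
have [w [mw wfin w0 _ wb]] := ACp_derivative_bound p1 (mA AG).
have [v [mv vfin v0 _ vb]] := ACp_derivative_bound p1 AG.
have M0 : 0 <= M by apply: le_trans (normc_ge0 (m 1)) (Mm _ _); rewrite ltr01 lexx.
(* [u] dominates [(m G)' - m G'], which is [m' G]; the factor 1 gives it the shape of
   [Lnorm_lin_lty]. *)
pose u x := 1 * w x + M * v x.
have mu_u : measurable_fun [set: R] u.
  by apply: measurable_funD; exact: measurable_funM.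
have ufin : (N u < +oo)%E by exact: Lnorm_lin_lty.
have Nfin : N u \is a fin_num by rewrite ge0_fin_numE// Lnorm_ge0.
apply: (@nat_not_bounded (fine (N u))) => k.
have [t01 mt] := eP k; have /andP[t0 t1] := t01.
pose c := (2 ^ k.+1)%:R^-1 * e k `^ kappa.
have k0 : 0 < e k `^ kappa by exact: powR_gt0.
have pw : 0 < (2 ^ k.+1)%:R :> R by rewrite ltr0n expn_gt0.
have c0 : 0 < c by rewrite mulr_gt0// invr_gt0.
have [h [_ _ _ dm]] := abs_continuous_ae_derivative (ltW t1) (acm _ t01).
have {}dm := lebesgue_ae_itvcc dm.
(* On [[e k, 1]] the test function is at least [c], so there the modulus of [m'] is at most
   [u / c]. *)
have key : (Lpnorm p `[e k, 1%R] (cderive m) <= (c^-1)%:E * N u)%E.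
  rewrite -LnormM//; last by rewrite invr_ge0 ltW.
  apply: Lpnorm_ae_le => //.
  have wv : {ae mu, forall x, `[0, 1]%classic x ->
     [/\ normc (cderive ('valL_0 (mulfun m g)) x) <= w x, cderivable ('valL_0 g) x &
         normc (cderive ('valL_0 g) x) <= v x]}.
    by apply: lebesgue_aeS2 wb vb => x wx vx x01; have [_ ?] := wx x01; have [? ?] := vx x01.
  apply: lebesgue_aeS2 wv dm => x wv dm ex1.
  have /andP[ex x1] : e k <= x <= 1 by move: ex1; rewrite /= in_itv.
  have x0 : 0 < x by exact: lt_le_trans ex.
  have x01 : `[0, 1]%classic x by rewrite /= in_itv/= x1 (ltW x0).
  have [{}wx dg vx] := wv x01; have [dmx _] := dm ex1.
  have := wx; rewrite valL0_mulfun; last exact: ACp0.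
  have [_ ->] := cderivableM dmx dg => {}wx.
  have gx : 'valL_0 g x = (G x)%:C.
    by rewrite (valL0_in (F := fun x => (G x)%:C))// (ltW x0).
  have cG : c <= G x by apply: eG; rewrite ex.
  have u0 : 0 <= u x by rewrite addr_ge0 ?mulr_ge0.
  rewrite ger0_norm; last by rewrite mulr_ge0// invr_ge0 ltW.
  rewrite ler_pdivlMl// mulrC.
  apply: (@le_trans _ _ (normc (cderive m x * 'valL_0 g x))).
    by rewrite gx normcM normcR ler_wpM2l ?normc_ge0// (le_trans cG)// ler_norm.
  have -> : cderive m x * 'valL_0 g x = (cderive m x * 'valL_0 g x + m x * cderive ('valL_0 g) x)
     - m x * cderive ('valL_0 g) x by rewrite addrK.
  rewrite (le_trans (le_normcD _ _))// normcN /u mul1r lerD// normcM.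
  by rewrite ler_pM ?normc_ge0// Mm// x0.
have := lt_le_trans mt key.
rewrite -(fineK Nfin) -EFinM lte_fin /c powRN invfM invrK => H.
(* Both sides contain the factor [c^-1]; cancelling it leaves [k] below the fixed norm of [u]. *)
have : k%:R * ((2 ^ k.+1)%:R * (e k `^ kappa)^-1) < fine (N u) * ((2 ^ k.+1)%:R * (e k `^ kappa)^-1).
  by move: H; rewrite mulrA [ltRHS]mulrC.
by rewrite ltr_pM2r ?mulr_gt0 ?invr_gt0// => /ltW.
Qed.

End symbol.

End multipliers.

Theorem theorem3 (R : realType) (p : \bar R) (hp : (1 <= p)%E)
    (T : {fun ACp (R := R) p >-> ACp (R := R) p}) :
  multiplier T <->
  exists m : R -> R[i],
    [/\ exists M : R, forall t : R, 0 < t <= 1 -> normc (m t) <= M,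
        {within `]0, 1], continuous (m : R -> R[i]^o)},
        forall g, ACp p g -> T g = mulfun m g,
        forall eps : R, 0 < eps < 1 ->
          abs_continuous eps 1 m /\ in_Lp p `[eps, 1] (cderive m)
      & exists A : R, forall eps : R, 0 < eps < 1 ->
          (Lpnorm p `[eps, 1%R] (cderive m)
             <= (A * eps `^ (- fine ((hoelder_conjugate p)^-1)%E))%R%:E)%E].
Proof.
split=> [Tmul|[m [_ _ Tm _ _]]]; last exact: (mulfun_multiplier hp Tm).
have TA g : ACp p g -> ACp p (T g) by exact: (@funS _ _ _ _ T).
have idA : ACp p (@unit_id R) by exact: ACp_id.
pose F := 'valL_0 (T (@unit_id R)).
pose m x := F x * (x^-1)%:C.
have Tm g : ACp p g -> T g = mulfun m g.
  move=> gA; apply/funext => t; rewrite /mulfun.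
  (* At 0 both sides vanish because [T g] is in AC_p; elsewhere the two multiplier identities for
     the pair [unit_id], [g] are divided by [t]. *)
  case: eqP => [t0|/eqP t0].
    by have [_ + _] := TA g gA; rewrite -t0 valL0_val.
  have := Tmul _ _ idA gA => -[E1 E2].
  have : unit_id t * T g t = T (@unit_id R) t * g t.
    by have := congr1 (fun h => h t) (etrans (esym E1) E2).
  rewrite /unit_id => E; rewrite /m /F valL0_val.
  rewrite mulrAC -E mulrAC -rmorphM/= mulfV// mul1r.
  by [].
have mA g : ACp p g -> ACp p (mulfun m g) by move=> gA; rewrite -(Tm g gA); exact: TA.
have [acF _ [_ Fp]] := TA _ idA.
have acm eps : 0 < eps < 1 -> abs_continuous eps 1 m.
  move=> /andP[e0 e1]; apply: abs_continuousM; first exact: ltW.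
    exact: abs_continuous_sub (ltW e0) (lexx 1) acF.
  exact: abs_continuous_inv.
exists m; split => //.
- exact: (symbol_bounded hp mA).
- exact: abs_continuous_within_continuous.
- move=> eps e01; split; first exact: acm.
  have /andP[e0 e1] := e01.
  apply: in_Lp_cderiveM => //; first exact: ltW.
  + exact: abs_continuous_sub (ltW e0) (lexx 1) acF.
  + exact: abs_continuous_inv.
  (* The norm over [[eps, 1]] is at most the norm over [[0, 1]]. *)
  + apply: le_lt_trans Fp; rewrite {2}/Lpnorm; apply: Lpnorm_ae_le => //.
    apply: nearW => x /= xe; rewrite indicE mem_set; last first.
      by move: xe; rewrite /= !in_itv/= => /andP[/(le_trans (ltW e0)) -> ->].
    by rewrite mulr1 ger0_norm ?normc_ge0.
  + by have [] := in_Lp_cderive_inv hp e0 (ltW e1).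
- exact: (symbol_derivative_bound hp mA acm).
Qed.
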